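(* Let $\Sigma$ be a complete fan in $\mathbb{R}^n$, let $\phi:\mathbb{R}^n\to\mathbb{R}$ be a strictly concave rational PL function on $\Sigma$, and let $r\in\mathbb{N}^+$ be such that $r\phi$ is integral. If $\phi(u_\rho)<0$ for all $\rho\in\Sigma(1)$, then for all $\delta\in(0,\infty)$ and all $\epsilon=(\epsilon_\rho)_{\rho\in\Sigma(1)}\in\mathbb{R}_{>0}^{\Sigma(1)}$ such that $\epsilon_\rho<-r\phi(u_\rho)$ for all $\rho\in\Sigma(1)$, the one-form $\theta_{r\phi}$ restricts to a contact form on the hypersurface $\partial W_{\epsilon,\delta}(r\phi)=H_{r\phi,\epsilon}^{-1}(\delta)\subset(\mathbb{C}^\times)^n$.
   Context: Let $n\ge 1$. A complete fan $\Sigma$ in $\mathbb{R}^n$ is a finite collection of strongly convex rational polyhedral cones, closed under taking faces and intersections (two cones meet along a common face), whose union is $\mathbb{R}^n$. $\Sigma(k)$ is the set of $k$-dimensional cones; for a ray $\rho\in\Sigma(1)$, $u_\rho\in\mathbb{Z}^n$ is its primitive generator. A PL function on $\Sigma$ is a continuous $\phi:\mathbb{R}^n\to\mathbb{R}$ linear on each cone; for $\sigma\in\Sigma(n)$ write $\phi|_\sigma=\langle m_\sigma,\cdot\rangle$. It is rational (resp. integral) if all $m_\sigma\in\mathbb{Q}^n$ (resp. $\mathbb{Z}^n$). It is strictly concave if $\phi(x)=\min_{\sigma\in\Sigma(n)}\langle m_\sigma,x\rangle$ for all $x$ and, for every $\sigma\in\Sigma(n)$, $\phi(x)=\langle m_\sigma,x\rangle$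 if and only if $x\in\sigma$. Set $P_{r\phi}=\{m\in\mathbb{R}^n:\langle m,u_\rho\rangle\ge r\phi(u_\rho)\ \forall\rho\in\Sigma(1)\}$. For $m=(m^{(1)},\dots,m^{(n)})\in\mathbb{Z}^n$ let $\chi^m(z)=z_1^{m^{(1)}}\cdots z_n^{m^{(n)}}$ on $(\mathbb{C}^\times)^n$. Define on $(\mathbb{C}^\times)^n$ $$\theta_{r\phi}=-\frac{i}{2}\sum_{k=1}^n\frac{\sum_{m\in P_{r\phi}\cap\mathbb{Z}^n}m^{(k)}|\chi^m|^2}{\sum_{m\in P_{r\phi}\cap\mathbb{Z}^n}|\chi^m|^2}\left(\frac{dz_k}{z_k}-\frac{d\overline{z}_k}{\overline{z}_k}\right),\qquad \omega_{r\phi}=d\theta_{r\phi},$$ $\omega_{r\phi}$ being a symplectic form, and the moment map $$\mu_{r\phi}=\frac{\sum_{m\in P_{r\phi}\cap\mathbb{Z}^n}|\chi^m|^2\,m}{\sum_{m\in P_{r\phi}\cap\mathbb{Z}^n}|\chi^m|^2}:(\mathbb{C}^\times)^n\to\mathbb{R}^n,$$ whose image is $\operatorname{int}(P_{r\phi})$. For $\rho\in\Sigma(1)$ let $r_\rho(m)=\langle m,u_\rho\rangle-r\phi(u_\rho)$. For $\epsilon_\rho>0$ let $q_{\epsilon_\rho}:[0,\infty)\to[0,1]$ be $q_{\epsilon_\rho}(x)=\exp\left(-\frac{x^2}{\epsilon_\rho^2(\epsilon_\rho^2-x^2)}\right)$ for $x\in[0,\epsilon_\rho)$ and $q_{\epsilon_\rho}(x)=0$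 for $x\ge\epsilon_\rho$. Let $h_{r\phi,\epsilon}(m)=\sum_{\rho\in\Sigma(1)}q_{\epsilon_\rho}(r_\rho(m))$ and $H_{r\phi,\epsilon}=h_{r\phi,\epsilon}\circ\mu_{r\phi}$ (the polyhedral Hamiltonian), and $W_{\epsilon,\delta}(r\phi)=\{z\in(\mathbb{C}^\times)^n: H_{r\phi,\epsilon}(z)\le\delta\}$. A contact form on a $(2n-1)$-manifold is a one-form $\alpha$ with $\alpha\wedge(d\alpha)^{n-1}$ nowhere vanishing. *)

(* Defs.v *)
From HB Require Import structures.
From mathcomp Require Import all_boot all_order all_algebra all_fingroup.
From mathcomp Require Import all_classical all_reals all_analysis.
From mathcomp Require Import complex.

Set Implicit Arguments.
Unset Strict Implicit.
Unset Printing Implicit Defensive.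

Import Order.TTheory GRing.Theory Num.Theory.
Import numFieldNormedType.Exports.

Local Open Scope classical_set_scope.
Local Open Scope ring_scope.

Section Fans.
Context {R : realType} {n : nat}.
Implicit Types (u : 'rV[int]_n) (m l x : 'rV[R]_n).
Implicit Types (sigma tau rho : set 'rV[R]_n) (Sigma : set (set 'rV[R]_n)).
Implicit Types (phi psi : 'rV[R]_n -> R).

Definition dotv m x : R := \sum_(k < n) m 0 k * x 0 k.

Definition intv u : 'rV[R]_n := map_mx intr u.

Definition ratv (q : 'rV[rat]_n) : 'rV[R]_n := map_mx ratr q.

Definition cone_of (S : seq 'rV[int]_n) : set 'rV[R]_n :=
  [set x | exists c : 'I_(size S) -> R,
     (forall i, 0 <= c i) /\ x = \sum_i c i *: intv (nth 0 S i)].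

Definition rational_polyhedral_cone sigma : Prop := exists S, sigma = cone_of S.

Definition strongly_convex sigma : Prop :=
  forall x, sigma x -> sigma (- x) -> x = 0.

Definition is_face tau sigma : Prop :=
  exists l, (forall x, sigma x -> 0 <= dotv l x) /\
            tau = sigma `&` [set x | dotv l x = 0].

(* The rows of A form a basis, consisting of vectors of sigma, of the linear
   span of sigma. *)
Definition cone_dim sigma (k : nat) : Prop :=
  exists A : 'M[R]_(k, n),
    [/\ row_free A, forall i, sigma (row i A)
      & forall x, sigma x -> (x <= A)%MS].

Definition complete_fan Sigma : Prop :=
  [/\ finite_set Sigma,
      forall sigma, Sigma sigma ->
        rational_polyhedral_cone sigma /\ strongly_convex sigma,
      forall sigma tau, Sigma sigma -> is_face tau sigma -> Sigma tau,
      forall sigma tau, Sigma sigma -> Sigma tau ->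
        [/\ Sigma (sigma `&` tau), is_face (sigma `&` tau) sigma
          & is_face (sigma `&` tau) tau]
    & \bigcup_(sigma in Sigma) sigma = setT].

Definition cones Sigma (k : nat) : set (set 'rV[R]_n) :=
  [set sigma | Sigma sigma /\ cone_dim sigma k].

Definition primitive u : Prop := \big[gcdn/0%N]_(k < n) absz (u 0 k) = 1%N.

(* u_rho; the set below is a singleton when rho is a rational ray. *)
Definition prim_gen rho : 'rV[R]_n :=
  intv (xget 0 [set u | primitive u /\ rho = cone_of [:: u]]).

Definition PL Sigma phi : Prop :=
  continuous phi /\
  forall sigma, Sigma sigma ->
    exists m, forall x, sigma x -> phi x = dotv m x.

(* m_sigma; it exists and is unique when phi is PL and sigma is a
   full-dimensional cone of the fan. *)
Definition slope phi sigma : 'rV[R]_n :=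
  xget 0 [set m | forall x, sigma x -> phi x = dotv m x].

Definition rational_PL Sigma phi : Prop :=
  PL Sigma phi /\
  forall sigma, cones Sigma n sigma -> exists q, slope phi sigma = ratv q.

Definition integral_PL Sigma phi : Prop :=
  PL Sigma phi /\
  forall sigma, cones Sigma n sigma -> exists u, slope phi sigma = intv u.

Definition strictly_concave Sigma phi : Prop :=
  [/\ forall x sigma, cones Sigma n sigma -> phi x <= dotv (slope phi sigma) x,
      forall x, exists2 sigma, cones Sigma n sigma &
        phi x = dotv (slope phi sigma) x
    & forall sigma, cones Sigma n sigma ->
        forall x, phi x = dotv (slope phi sigma) x <-> sigma x].

Definition polytope Sigma psi : set 'rV[R]_n :=
  [set m | forall rho, cones Sigma 1 rho ->
     psi (prim_gen rho) <= dotv m (prim_gen rho)].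

Definition lattice_points Sigma psi : set 'rV[int]_n :=
  [set u | polytope Sigma psi (intv u)].

End Fans.

Section Torus.
Context {R : realType} {n : nat}.

(* C^n as a real normed space: the pair (x, y) stands for z = x + iy. *)
Definition Cn : normedModType R := ('rV[R]_n * 'rV[R]_n)%type.

Implicit Types (z v : Cn) (u : 'rV[int]_n).
Implicit Types (Sigma : set (set 'rV[R]_n)) (psi : 'rV[R]_n -> R).

Definition coordC z (k : 'I_n) : R[i] := Complex (z.1 0 k) (z.2 0 k).

Definition torus : set Cn := [set z | forall k, coordC z k != 0].

Definition character u z : R[i] := \prod_(k < n) coordC z k ^ u 0 k.

Definition weight u z : R := ComplexField.Normc.normc (character u z) ^+ 2.

(* Finitely supported sums: the lattice points of the polytope of a PL function
   on a complete fan form a finite set. *)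
Definition total_weight Sigma psi z : R :=
  \sum_(u \in lattice_points Sigma psi) weight u z.

Definition moment_map Sigma psi z : 'rV[R]_n :=
  (total_weight Sigma psi z)^-1 *:
    \sum_(u \in lattice_points Sigma psi) weight u z *: intv u.

(* Value at z, on the tangent vector v, of the one-form theta; dz_k(v) is the
   k-th complex coordinate of v. *)
Definition thetaC Sigma psi z v : R[i] :=
  - (Complex 0 1 / 2) * \sum_(k < n)
    real_complex R ((\sum_(u \in lattice_points Sigma psi)
                        (u 0 k)%:~R * weight u z) / total_weight Sigma psi z) *
    (coordC v k / coordC z k - conjc (coordC v k) / conjc (coordC z k)).

Lemma thetaC_real Sigma psi z v : complex.Im (thetaC Sigma psi z v) = 0.
Proof.
have E (c : R) (w : R[i]) :
    real_complex R c * (w - conjc w) = Complex 0 (c * (complex.Im w *+ 2)).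
  case: w => a b; rewrite /real_complex_def /=; simpc.
  by rewrite mulr2n.
have S (F : 'I_n -> R) :
    \sum_k Complex 0 (F k) = Complex 0 (\sum_k F k) :> R[i].
  elim/big_rec2: _ => // k y1 y2 _ ->.
  by simpc.
rewrite /thetaC (eq_bigr (fun k => Complex 0
  ((\sum_(u \in lattice_points Sigma psi) (u 0 k)%:~R * weight u z)
    / total_weight Sigma psi z
    * (complex.Im (coordC v k / coordC z k) *+ 2)))); last first.
  by move=> k _; rewrite -conjc_inv -rmorphM E.
rewrite S.
have -> : Complex 0 1 / 2 = Complex 0 (2^-1) :> R[i].
  rewrite -[2]/(2%:R) -(rmorph_nat (real_complex R)) -fmorphV.
  by rewrite /real_complex_def /=; simpc.
by simpc.
Qed.

Definition theta Sigma psi z v : R := complex.Re (thetaC Sigma psi z v).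

Definition slack psi (rho : set 'rV[R]_n) (m : 'rV[R]_n) : R :=
  dotv m (prim_gen rho) - psi (prim_gen rho).

(* Only meaningful for x >= 0. *)
Definition cutoff (e x : R) : R :=
  if x < e then expR (- (x ^+ 2 / (e ^+ 2 * (e ^+ 2 - x ^+ 2)))) else 0.

Definition hamiltonian_base Sigma psi (eps : set 'rV[R]_n -> R)
    (m : 'rV[R]_n) : R :=
  \sum_(rho \in cones Sigma 1) cutoff (eps rho) (slack psi rho m).

Definition hamiltonian Sigma psi eps z : R :=
  hamiltonian_base Sigma psi eps (moment_map Sigma psi z).

Definition sublevel Sigma psi eps (delta : R) : set Cn :=
  [set z | torus z /\ hamiltonian Sigma psi eps z <= delta].

Definition level Sigma psi eps (delta : R) : set Cn :=
  [set z | torus z /\ hamiltonian Sigma psi eps z = delta].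

(* Topological boundary of A in the subspace U, for U open and A included in
   U. *)
Definition boundary_in (U A : set Cn) : set Cn :=
  U `&` (closure A `\` interior A).

End Torus.
Arguments Cn : clear implicits.

Section Forms.
Context {R : realType} {V : normedModType R}.

(* C^oo on the open set U: all iterated directional derivatives exist and are
   continuous on U. *)
Definition iter_derive (vs : seq V) (f : V -> R) : V -> R :=
  foldr (fun v g => 'D_v g) f vs.

Definition smooth_on (U : set V) (f : V -> R) : Prop :=
  forall (vs : seq V) z, U z ->
    {for z, continuous (iter_derive vs f)} /\
    forall v, derivable (iter_derive vs f) z v.

(* Values of k-forms at a point. *)
Definition kform (k : nat) := ('I_k -> V) -> R.

Definition wedge k l (a : kform k) (b : kform l) : kform (k + l) :=
  fun v => (k`!%:R * l`!%:R)^-1 *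
    \sum_(s : 'S_(k + l)) (-1) ^+ s *
      (a (fun i => v (s (lshift l i))) * b (fun j => v (s (rshift k j)))).

Fixpoint wedge_pow2 (b : kform 2) (j : nat) : kform (j * 2) :=
  match j with
  | 0 => fun=> 1
  | j'.+1 => wedge b (@wedge_pow2 b j')
  end.
Arguments wedge_pow2 b j v : clear implicits.

Definition smooth_one_form_on (U : set V) (alpha : V -> V -> R) : Prop :=
  (forall z, U z -> forall (a : R) (v w : V),
     alpha z (a *: v + w) = a * alpha z v + alpha z w) /\
  forall v, smooth_on U (fun z => alpha z v).

Definition form1 (alpha : V -> V -> R) (z : V) : kform 1 :=
  fun v => alpha z (v ord0).

Definition ext_d (alpha : V -> V -> R) (z : V) : kform 2 :=
  fun v => let v0 := v ord0 in let v1 := v ord_max in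
    'D_v0 (fun w => alpha w v1) z - 'D_v1 (fun w => alpha w v0) z.

(* F is a local defining function of S near z, with nonzero differential at
   z. *)
Definition local_equation (S : set V) (z : V) (F : V -> R) : Prop :=
  exists O : set V,
    [/\ open O, O z, smooth_on O F, S `&` O = O `&` [set w | F w = 0]
      & exists v, 'D_v F z != 0].

Definition hypersurface (S : set V) : Prop :=
  forall z, S z -> exists F, local_equation S z F.

(* T_z S, the kernel of the differential of a local defining function (which
   does not depend on the choice of that function). *)
Definition tangent_space (S : set V) (z : V) : set V :=
  [set v | exists2 F, local_equation S z F & 'D_v F z = 0].

(* The ambient space has real dimension 2n and S is a hypersurface, so that
   alpha /\ (d alpha)^(n-1) is a form of top degree on S.  The pullback to S
   commutes with wedge products and with the exterior derivative, hence the form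
   built from the restriction of alpha to S is the restriction to T_z S of the
   ambient alpha /\ (d alpha)^(n-1). *)
Definition restricts_to_contact_form (n : nat) (S : set V)
    (alpha : V -> V -> R) : Prop :=
  [/\ hypersurface S,
      exists U : set V, [/\ open U, S `<=` U & smooth_one_form_on U alpha]
    & forall z, S z -> exists v : 'I_(1 + n.-1 * 2) -> V,
        (forall i, tangent_space S z (v i)) /\
        wedge (form1 alpha z) (wedge_pow2 (ext_d alpha z) n.-1) v != 0].

End Forms.
Arguments wedge_pow2 {R V} b j v.

(* Main.v *)
(* In logarithmic coordinates z_k = exp(x_k + i t_k) one has theta = sum_k mu_k dt_k,
   so omega = sum_k dmu_k /\ dt_k and the Liouville field of (omega, theta) is the
   radial field sum_k mu_k d/dmu_k.  It increases H on the level: a ray with nonzero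
   cutoff has slack below eps, whence <mu, u_rho> = slack + psi(u_rho) < 0, while the
   cutoff decreases in the slack.  Hence the level is a hypersurface transverse to a
   Liouville field.  Transversality is turned into nonvanishing of
   theta /\ omega^(n-1) by evaluating the form on a Reeb vector followed by a
   symplectic family.  That mu is an immersion in x comes from the positivity of a
   covariance matrix: the slopes of rphi are lattice points of the polytope, and no
   nonzero functional is constant on them since the maximal cones are strongly
   convex.  That there are finitely many lattice points comes from Gordan's
   alternative: strongly convex polyhedral cones are generated by their rays. *)
Require Import Defs.
From HB Require Import structures.
From mathcomp Require Import all_boot all_order all_algebra all_fingroup.
From mathcomp Require Import all_classical all_reals all_analysis.
From mathcomp Require Import complex.
From mathcomp Require Import finmap ring lra zify.
Set Implicit Arguments.
Unset Strict Implicit.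
Unset Printing Implicit Defensive.
Import Order.TTheory GRing.Theory Num.Theory.
Import numFieldNormedType.Exports.
Local Open Scope classical_set_scope.
Local Open Scope ring_scope.

(** * Alternating forms *)

Section PermutationSums.
Variable R : comNzRingType.

(** As in a Laplace expansion, a permutation amounts to the image [i] of 0 together with a
    permutation of the remaining points. *)
Lemma sum_perm_ordS m (F : 'S_m.+1 -> R) :
  \sum_s F s = \sum_i \sum_(t : 'S_m) F (lift_perm ord0 i t).
Proof.
rewrite (partition_big (fun s : 'S_m.+1 => s ord0) xpredT) //=.
apply: eq_bigr => i _.
rewrite (reindex (lift_perm ord0 i)); last first.
  (* Deletes 0 and its image from [s]. The default [k] is never returned, as [s (lift ord0 k)]
     differs from [s ord0]. *)
  pose ulsf (s : 'S_m.+1) k := odflt k (unlift (s ord0) (s (lift ord0 k))).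
  have ulsfK (s : 'S_m.+1) k : lift (s ord0) (ulsf s k) = s (lift ord0 k).
    rewrite /ulsf; have:= neq_lift ord0 k.
    by rewrite -(can_eq (permK s)) => /unlift_some[] ? ? ->.
  have inj_ulsf s : injective (ulsf s).
    move=> k1 k2 E; apply: (@lift_inj _ ord0); apply: (@perm_inj _ s).
    by rewrite -!ulsfK E.
  exists (fun s => perm (inj_ulsf s)) => [s _ | s].
    apply/permP=> k'; rewrite permE /ulsf lift_perm_lift lift_perm_id.
    by rewrite liftK.
  move/eqP=> si; apply/permP=> k.
  case: (unliftP ord0 k) => [k'|] ->; rewrite ?lift_perm_id ?lift_perm_lift -si //.
  by rewrite permE ulsfK.
by apply: eq_bigl => t; rewrite lift_perm_id eqxx.
Qed.

End PermutationSums.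

Section WedgeExpansion.
Context {R : realType} {V : normedModType R}.
Implicit Types (k l m : nat).

Definition alternating_form k (a : @kform R V k) : Prop :=
  forall (v : 'I_k -> V) (t : 'S_k), a (v \o t) = (-1) ^+ t * a v.

(** The wedge sums over all permutations, so precomposing with [t] reindexes the sum and only the
    sign of [t] comes out. *)
Lemma alternating_wedge k l (a : @kform R V k) (b : @kform R V l) :
  alternating_form (wedge a b).
Proof.
move=> v t; rewrite /wedge mulrCA; congr (_ * _).
rewrite mulr_sumr (reindex_inj (mulIg t^-1)%g) /=; apply: eq_bigr => s _.
rewrite odd_permM odd_permV signr_addb [X in X * _]mulrC -mulrA; congr (_ * (_ * _)).
congr (a _ * b _); apply/funext => i /=; rewrite ?permM ?permKV //.
Qed.

Lemma alternating_wedge_pow2 (b : @kform R V 2) j : alternating_form (wedge_pow2 b j).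
Proof.
case: j => [|j]; last exact: alternating_wedge.
by move=> v t; rewrite /= mulr1; have -> : t = 1%g; [apply/permP => -[] | rewrite odd_perm1].
Qed.

Lemma sum_sign_alternating m (b : @kform R V m) (v : 'I_m -> V) :
  alternating_form b ->
  \sum_(t : 'S_m) (-1) ^+ t * b (v \o t) = m`!%:R * b v.
Proof.
move=> altb; rewrite (eq_bigr (fun=> b v)) => [|t _]; last first.
  by rewrite altb mulrA -signr_addb addbb mul1r.
by rewrite sumr_const card_Sn mulr_natl.
Qed.

(** Permutations with the same image of 0 give equal terms because [b] alternates; there are m! of
    them, which cancels the normalizing factor. *)
Lemma wedge1E m (a : @kform R V 1) (b : @kform R V m) (v : 'I_(1 + m) -> V) :
  alternating_form b ->
  wedge a b v =
  \sum_(i < m.+1) (-1) ^+ i * a (fun=> v i) * b (fun x => v (lift i x)).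
Proof.
move=> altb; rewrite /wedge /= (@sum_perm_ordS R m) mulr_sumr; apply: eq_bigr => i _.
have mf : m`!%:R != 0 :> R by rewrite pnatr_eq0 -lt0n fact_gt0.
rewrite (eq_bigr (fun t : 'S_m => (-1) ^+ i * a (fun=> v i) *
    ((-1) ^+ t * b ((fun x => v (lift i x)) \o t)))) => [|t _].
  rewrite -mulr_sumr sum_sign_alternating // (_ : 1`! = 1%N) // mul1r.
  by rewrite mulrCA [_^-1 * _]mulKf.
rewrite odd_lift_perm signr_addb signr_odd /= -!mulrA; congr (_ * _).
rewrite mulrCA; congr (_ * (_ * _)).
  congr a; apply/funext => x.
  by rewrite (_ : lshift m x = ord0) ?lift_perm_id //; apply/val_inj; case: x => -[].
congr b; apply/funext => x /=.
by rewrite (_ : rshift 1 x = lift ord0 x) ?lift_perm_lift //; apply/val_inj.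
Qed.

(** The ordered pair (i, [lift i j]) feeds [a], and the permutations of the other arguments cancel
    m!. The factor 1/2 stays, since each unordered pair occurs in both orders. *)
Lemma wedge2E m (a : @kform R V 2) (b : @kform R V m) (v : 'I_(2 + m) -> V) :
  alternating_form b ->
  wedge a b v = 2^-1 *
  \sum_(i < m.+2) \sum_(j < m.+1) (-1) ^+ (i + j) *
    a (fun x : 'I_2 => if x == ord0 then v i else v (lift i j)) *
    b (fun x => v (lift i (lift j x))).
Proof.
move=> altb; rewrite /wedge /= (@sum_perm_ordS R m.+1) !mulr_sumr; apply: eq_bigr => i _.
rewrite (@sum_perm_ordS R m) !mulr_sumr; apply: eq_bigr => j _.
have mf : m`!%:R != 0 :> R by rewrite pnatr_eq0 -lt0n fact_gt0.
set A := a _; set B := b _.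
rewrite (eq_bigr (fun t : 'S_m => (-1) ^+ (i + j) * A *
    ((-1) ^+ t * b ((fun x => v (lift i (lift j x))) \o t)))) => [|t _].
  rewrite -mulr_sumr sum_sign_alternating // (_ : 2`! = 2%N) // invfM -[LHS]mulrA.
  by congr (_ * _); rewrite mulrCA mulKf.
rewrite !odd_lift_perm; move: (odd_perm t) => o; rewrite !signr_addb !signr_odd /= !expr0 !mul1r.
rewrite exprD -!mulrA.
congr (_ * (_ * _)). rewrite mulrCA; congr (_ * (_ * _)).
  congr a; apply/funext => x; case: eqP => [->|/eqP x0].
    by rewrite (_ : lshift m ord0 = ord0) ?lift_perm_id //; apply/val_inj.
  rewrite (_ : lshift m x = lift ord0 ord0) ?lift_perm_lift ?lift_perm_id //.
  by apply/val_inj => /=; case: x x0 => -[|[]].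
congr b; apply/funext => x /=.
by rewrite (_ : rshift 2 x = lift ord0 (lift ord0 x)) ?lift_perm_lift //; apply/val_inj.
Qed.

(** A Darboux family: consecutive vectors e = w_(2a), f = w_(2a+1) satisfy b(e, f) = 1 = -b(f, e),
    and all other pairings vanish. The map [f] encodes a pair of indices. *)
Definition symplectic_family (b : @kform R V 2) j (w : 'I_(j * 2) -> V) : Prop :=
  forall f : 'I_2 -> 'I_(j * 2),
    b (w \o f) = if (f ord0)./2 == (f ord_max)./2
                 then (odd (f ord_max))%:R - (odd (f ord0))%:R else 0.

(* In wedge2E only the pairs {2a, 2a+1} contribute; each contribution is positive,
   since deleting such a pair leaves a symplectic family. *)
Lemma wedge_pow2_symplectic_gt0 (b : @kform R V 2) j (w : 'I_(j * 2) -> V) :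
  symplectic_family b w -> 0 < wedge_pow2 b j w.
Proof.
elim: j w => [|j IH] w sw; first by rewrite /= ltr01.
rewrite [wedge_pow2 _ _]/= (wedge2E _ _ (@alternating_wedge_pow2 b j)).
rewrite mulr_gt0 ?invr_gt0 ?ltr0n //.
have pos (i : 'I_(j * 2).+2) (k : 'I_(j * 2).+1) : i./2 = (lift i k)./2 ->
  0 < (-1) ^+ (i + k) * b (fun x => if x == ord0 then w i else w (lift i k)) *
      wedge_pow2 b j (fun x => w (lift i (lift k x))).
  move=> eik.
  (* [k] numbers the family with [i] removed; in that numbering the partner of [i] has the even
     position 2 floor(i/2), whatever the parity of [i]. *)
  have ki : val k = (i./2).*2.
    have := neq_lift i k; rewrite -val_eqE /=; move: eik; rewrite /= /bump.
    have [h|h] := leqP i k; rewrite ?add0n ?add1n; lia.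
  have nik : odd (lift i k) = ~~ odd i.
    by have := neq_lift i k; rewrite -val_eqE /=; move: eik; rewrite /=; lia.
  have := sw (fun x => if x == ord0 then i else lift i k).
  rewrite /= -[X in b X]/(w \o _).
  rewrite (_ : w \o _ = fun x => if x == ord0 then w i else w (lift i k)); last first.
    by apply/funext => x /=; case: ifP.
  move=> ->; rewrite eik eqxx nik.
  (* As [k] is even, the sign is (-1)^i, which is also the value of [b] on the pair. *)
  apply: mulr_gt0.
    rewrite ki exprD -signr_odd -[X in _ * X * _]signr_odd odd_double mulr1.
    by case: (odd i); rewrite /= ?expr1 ?expr0 ?subr0 ?sub0r ?mulrNN ?mulr1 ltr01.
  apply: IH => f.
  rewrite [LHS](sw (fun x => lift i (lift k (f x)))).
  (* Removing the pair shifts later indices by 2, which preserves parities and the grouping into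
     pairs. *)
  have bmp (x : 'I_(j * 2)) : val (lift i (lift k x)) =
      (if (x < (i./2).*2)%N then val x else x.+2).
    rewrite /= /bump ki; case: leqP => h; case: leqP; lia.
  have hf x : odd (lift i (lift k (f x))) = odd (f x).
    by rewrite bmp; case: ifP => //=; rewrite negbK.
  rewrite !hf.
  set c := (X in if X then _ else _); set d := (X in _ = if X then _ else _).
  suff -> : c = d by [].
  rewrite {}/c {}/d !bmp /=; move: (i./2) (nat_of_ord (f ord0)) (nat_of_ord (f ord_max)) => h x y.
  by do 2 (case: ltnP => ? /=); apply/idP/idP => /eqP ?; apply/eqP; lia.
have ge0 (i : 'I_(j * 2).+2) (k : 'I_(j * 2).+1) :
  0 <= (-1) ^+ (i + k) * b (fun x => if x == ord0 then w i else w (lift i k)) *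
      wedge_pow2 b j (fun x => w (lift i (lift k x))).
  have [/pos/ltW//|ne] := eqVneq i./2 (lift i k)./2.
  have := sw (fun x => if x == ord0 then i else lift i k).
  rewrite /= (negbTE ne).
  rewrite (_ : w \o _ = fun x => if x == ord0 then w i else w (lift i k)); last first.
    by apply/funext => x /=; case: ifP.
  by move=> ->; rewrite mulr0 mul0r.
(* All terms are nonnegative; the pair {0, 1} provides a positive one. *)
rewrite (bigD1 ord0) //; apply: ltr_wpDr.
  by apply: sumr_ge0 => i _; apply: sumr_ge0 => k _; apply: ge0.
rewrite (bigD1 ord0) //; apply: ltr_wpDr; last exact: pos.
by apply: sumr_ge0 => k _; apply: ge0.
Qed.

End WedgeExpansion.

(** * Smooth functions *)

Section DirectionalDerivatives.
Context {R : realType} {V : normedModType R}.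
Implicit Types (f g : V -> R) (U : set V) (a v z : V).

Lemma cvg_is_derive f a v (l : R) :
  (fun h : R => h^-1 *: (f (h *: v + a) - f a)) @ 0^' --> l -> is_derive a v f l.
Proof. by move=> h; apply: DeriveDef; [apply: cvgP h | apply: cvg_lim h]. Qed.

Lemma is_derive_cvg f a v (l : R) : is_derive a v f l ->
  (fun h : R => h^-1 *: (f (h *: v + a) - f a)) @ 0^' --> l.
Proof. by case=> + <-; apply. Qed.

End DirectionalDerivatives.

Section Smoothness.
Context {R : realType} {V : normedModType R}.
Implicit Types (f g : V -> R) (U : set V) (a v z : V).

(** Restricting to the line t -> a + t v reduces the claim to the chain rule in one variable. *)
Lemma is_derive_comp_dir f (g : R -> R) a v (df dg : R) :
  is_derive a v f df -> is_derive (f a) 1 g dg -> is_derive a v (g \o f) (dg * df).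
Proof.
have E k : (fun h : R => h^-1 *: (k (h *: v + a) - k a)) =
   (fun h : R => h^-1 *: (k ((h *: (1 : R) + 0) *: v + a) - k (0 *: v + a))).
  by apply/funext => h; rewrite addr0 scale0r add0r [h *: 1]mulr1.
have line k (l : R) : is_derive a v k l <-> is_derive (0 : R) 1 (fun t => k (t *: v + a)) l.
  by split=> /is_derive_cvg kl; apply: cvg_is_derive; [rewrite -E | rewrite E].
move=> /line Hf Hg; apply/line.
apply: (@is_derive1_comp _ g (fun t => f (t *: v + a))) => //.
by rewrite scale0r add0r.
Qed.

Lemma is_derive_near_eq f g a v (l : R) U : open U -> U a ->
  (forall z, U z -> f z = g z) -> is_derive a v f l -> is_derive a v g l.
Proof.
move=> oU Ua fg; apply: near_eq_is_derive.
by near=> z; apply: fg; near: z; apply: open_nbhs_nbhs.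
Unshelve. all: by end_near. Qed.

Lemma is_derive_prod f g a v (df dg : R) : is_derive a v f df -> is_derive a v g dg ->
  is_derive a v (fun z => f z * g z) (f a * dg + df * g a).
Proof. by move=> hf hg; rewrite (mulrC df); apply: (is_deriveM hf hg). Qed.

Lemma is_derive_inv f a v (df : R) : f a != 0 -> is_derive a v f df ->
  is_derive a v (fun z => (f z)^-1) (- (df * ((f a)^-1 * (f a)^-1))).
Proof.
move=> fa0 [hf <-]; split; first exact: derivableV.
rewrite deriveV // expr2 invfM scaleNr; congr (- _); exact: mulrC.
Qed.

Lemma is_derive_bigsum (I : Type) (r : seq I) (F : I -> V -> R) a v (dF : I -> R) :
  (forall i, is_derive a v (F i) (dF i)) ->
  is_derive a v (fun z => \sum_(i <- r) F i z) (\sum_(i <- r) dF i).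
Proof.
move=> h; elim: r => [|i r IH].
  rewrite big_nil (_ : (fun _ => _) = cst 0); first exact: is_derive_cst.
  by apply/funext => z; rewrite big_nil.
rewrite big_cons (_ : (fun _ => _) = F i + (fun z => \sum_(i <- r) F i z)).
  exact: is_deriveD.
by apply/funext => z; rewrite big_cons.
Qed.

(** A C^k condition made recursive in [k], so that closure under the operations below goes by
    induction; [smooth_on] is recovered from all [k] together. *)
Fixpoint Ck U k f : Prop :=
  (forall z, U z -> {for z, continuous f}) /\
  if k is k'.+1 then
    forall v, (forall z, U z -> derivable f z v) /\ Ck U k' ('D_v f)
  else True.

Lemma Ck_continuous U k f z : Ck U k f -> U z -> {for z, continuous f}.
Proof. by case: k => [|k] [+ _]; apply. Qed.

Lemma CkW U k f : Ck U k.+1 f -> Ck U k f.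
Proof.
elim: k f => [|k IH] f; first by case.
by move=> [cf df]; split=> // v; have [dfv /IH] := df v.
Qed.

Lemma Ck_eq U k f g : open U -> (forall z, U z -> f z = g z) -> Ck U k f -> Ck U k g.
Proof.
move=> oU; have C h1 h2 : (forall z, U z -> h1 z = h2 z) ->
    (forall z, U z -> {for z, continuous h1}) -> forall z, U z -> {for z, continuous h2}.
  move=> h12 ch z Uz; rewrite /prop_for /continuous_at -h12 //.
  apply: cvg_trans (ch z Uz); apply: near_eq_cvg.
  by near=> y; apply: h12; near: y; apply: open_nbhs_nbhs.
elim: k f g => [|k IH] f g fg [cf]; first by move=> _; split=> //; apply: C fg cf.
move=> df; split; first exact: C fg cf.
move=> v; have [dfv Cfv] := df v; split.
  by move=> z Uz; have [] := is_derive_near_eq oU Uz fg (derivableP (dfv z Uz)).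
apply: IH Cfv => z Uz.
by have [_ ->] := is_derive_near_eq oU Uz fg (derivableP (dfv z Uz)).
Unshelve. all: by end_near. Qed.

(** It suffices to know a formula for the derivative on [U]; ['D_v f] may differ from it
    elsewhere. *)
Lemma CkS U k f : open U -> (forall z, U z -> {for z, continuous f}) ->
  (forall v, exists2 df : V -> R,
     (forall z, U z -> is_derive z v f (df z)) & Ck U k df) -> Ck U k.+1 f.
Proof.
move=> oU cf H; split=> // v; have [df hdf Cdf] := H v; split.
  by move=> z /hdf [].
by apply: Ck_eq Cdf => // z /hdf [_ ->].
Qed.

Lemma Ck_is_derive U k f v z : Ck U k.+1 f -> U z -> is_derive z v f ('D_v f z).
Proof. by move=> [_ /(_ v)[h _]] Uz; apply: derivableP; apply: h. Qed.

Lemma Ck_cst U k (c : R) : open U -> Ck U k (fun=> c).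
Proof.
move=> oU; elim: k c => [|k IH] c; first by split => // z _; apply: cvg_cst.
apply: CkS => // [z _|v]; first exact: cvg_cst.
by exists (fun=> 0) => // z _; apply: is_derive_cst.
Qed.

Lemma CkD U k f g : open U -> Ck U k f -> Ck U k g -> Ck U k (fun z => f z + g z).
Proof.
move=> oU; elim: k f g => [|k IH] f g Cf Cg.
  split=> // z Uz; apply: continuousD; [exact: (Ck_continuous Cf) | exact: (Ck_continuous Cg)].
apply: CkS => // [z Uz|v].
  apply: continuousD; [exact: (Ck_continuous Cf) | exact: (Ck_continuous Cg)].
exists (fun z => 'D_v f z + 'D_v g z).
  by move=> z Uz; apply: is_deriveD; [exact: (Ck_is_derive _ Cf) | exact: (Ck_is_derive _ Cg)].
by apply: IH; [have [_ /(_ v)[]] := Cf | have [_ /(_ v)[]] := Cg].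
Qed.

Lemma CkM U k f g : open U -> Ck U k f -> Ck U k g -> Ck U k (fun z => f z * g z).
Proof.
move=> oU; elim: k f g => [|k IH] f g Cf Cg.
  split=> // z Uz; apply: continuousM; [exact: (Ck_continuous Cf) | exact: (Ck_continuous Cg)].
apply: CkS => // [z Uz|v].
  apply: continuousM; [exact: (Ck_continuous Cf) | exact: (Ck_continuous Cg)].
exists (fun z => f z * 'D_v g z + 'D_v f z * g z).
  by move=> z Uz; apply: is_derive_prod; [exact: (Ck_is_derive _ Cf) | exact: (Ck_is_derive _ Cg)].
have [_ /(_ v)[_ Df]] := Cf; have [_ /(_ v)[_ Dg]] := Cg.
by apply: CkD => //; apply: IH => //; apply: CkW.
Qed.

Lemma CkN U k f : open U -> Ck U k f -> Ck U k (fun z => - f z).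
Proof.
move=> oU Cf; apply: (@Ck_eq _ _ (fun z => -1 * f z)) => //.
  by move=> z _; rewrite mulN1r.
by apply: CkM => //; apply: Ck_cst.
Qed.

Lemma CkB U k f g : open U -> Ck U k f -> Ck U k g -> Ck U k (fun z => f z - g z).
Proof. by move=> oU Cf Cg; apply: CkD => //; apply: CkN. Qed.

Lemma Ck_sum U k (I : Type) (r : seq I) (F : I -> V -> R) : open U ->
  (forall i, Ck U k (F i)) -> Ck U k (fun z => \sum_(i <- r) F i z).
Proof.
move=> oU CF; elim: r => [|i r IH].
  by apply: Ck_eq (Ck_cst k 0 oU) => // z _; rewrite big_nil.
by apply: Ck_eq (CkD oU (CF i) IH) => // z _; rewrite big_cons.
Qed.

Lemma Ck_prod U k (I : Type) (r : seq I) (F : I -> V -> R) : open U ->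
  (forall i, Ck U k (F i)) -> Ck U k (fun z => \prod_(i <- r) F i z).
Proof.
move=> oU CF; elim: r => [|i r IH].
  by apply: Ck_eq (Ck_cst k 1 oU) => // z _; rewrite big_nil.
by apply: Ck_eq (CkM oU (CF i) IH) => // z _; rewrite big_cons.
Qed.

Lemma CkV U k f : open U -> (forall z, U z -> f z != 0) -> Ck U k f ->
  Ck U k (fun z => (f z)^-1).
Proof.
move=> oU f0; elim: k => [|k IH] Cf.
  by split=> // z Uz; apply: continuousV; [exact: f0 | exact: (Ck_continuous Cf)].
apply: CkS => // [z Uz|v].
  by apply: continuousV; [exact: f0 | exact: (Ck_continuous Cf)].
exists (fun z => - ('D_v f z * ((f z)^-1 * (f z)^-1))).
  by move=> z Uz; apply: is_derive_inv; [exact: f0 | exact: (Ck_is_derive _ Cf)].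
have [_ /(_ v)[_ Df]] := Cf.
have IH' := IH (CkW Cf).
by apply: CkN => //; apply: CkM => //; apply: CkM.
Qed.

Lemma CkX U k f n : open U -> Ck U k f -> Ck U k (fun z => f z ^+ n).
Proof.
move=> oU Cf; elim: n => [|n IH]; first exact: Ck_cst.
by apply: Ck_eq (CkM oU Cf IH) => // z _; rewrite exprS.
Qed.

Lemma Ck_exprz U k f (m : int) : open U -> (forall z, U z -> f z != 0) -> Ck U k f ->
  Ck U k (fun z => f z ^ m).
Proof.
move=> oU f0 Cf; case: m => n; first exact: CkX.
by apply: CkV => // [z Uz|]; [rewrite expf_neq0 // f0 | exact: CkX].
Qed.

(** The family [G] is closed under differentiation through [next], so the chain rule stays inside it
    and induction on [k] applies. It serves for [flat], indexed by polynomials. *)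
Lemma Ck_comp_family U k f (I : Type) (G : I -> R -> R) (next : I -> I) (i : I) :
  open U -> Ck U k f ->
  (forall i (x : R), is_derive x 1 (G i) (G (next i) x)) -> Ck U k (fun z => G i (f z)).
Proof.
move=> oU + dG; have cG j : continuous (G j).
  move=> x; apply: differentiable_continuous; apply/derivable1_diffP.
  by have [] := dG j x.
have cf j g z : {for z, continuous g} -> {for z, continuous (fun z => G j (g z))}.
  by move=> cg; apply: continuous_comp => //; apply: cG.
elim: k i => [|k IH] i Cf.
  by split=> // z Uz; apply: cf; exact: (Ck_continuous Cf).
apply: CkS => // [z Uz|v]; first by apply: cf; exact: (Ck_continuous Cf).
exists (fun z => G (next i) (f z) * 'D_v f z).
  by move=> z Uz; apply: is_derive_comp_dir (dG _ _); exact: (Ck_is_derive _ Cf).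
have [_ /(_ v)[_ Df]] := Cf.
by apply: CkM => //; apply: IH; apply: CkW.
Qed.

Lemma Ck_smooth_on U f : (forall k, Ck U k f) -> smooth_on U f.
Proof.
move=> Cf vs z Uz.
suff {Cf} H k g : (forall k, Ck U k g) -> Ck U k (iter_derive vs g).
  have C1 := H 1%N f Cf; split; first exact: (Ck_continuous C1).
  by move=> v; have [_ /(_ v)[dg _]] := C1; apply: dg.
(* [foldr] differentiates along the last direction first. *)
elim/last_ind: vs k g => [|vs v IH] k g Cg; first exact: Cg.
rewrite /iter_derive foldr_rcons; apply: IH => j.
by have [_ /(_ v)[]] := Cg j.+1.
Qed.

End Smoothness.

(** * The flat function *)

Section FlatFunction.
Context {R : realType}.
Implicit Types (p : {poly R}) (x y : R).

(** The classical flat function exp(-1/y), extended by 0, times a polynomial in 1/y. This factor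
    makes the family stable under differentiation. *)
Definition flat p y : R := if 0 < y then p.[y^-1] * expR (- y^-1) else 0.

(** With t = 1/y one has d/dy = -t^2 d/dt, and the t-derivative of p(t) exp(-t) is (p' - p)(t)
    exp(-t). *)
Definition flat_next p : {poly R} := 'X^2 * (p - p^`()).

Lemma poly_bound p : exists2 C : R, 0 <= C &
  forall t, 1 <= t -> `|p.[t]| <= C * t ^+ size p.
Proof.
exists (\sum_(i < size p) `|p`_i|); first exact: sumr_ge0.
move=> t t1; rewrite horner_coef mulr_suml.
apply: le_trans (ler_norm_sum _ _ _) _; apply: ler_sum => i _.
rewrite normrM normrX (ger0_norm (le_trans ler01 t1)) ler_wpM2l //.
by rewrite ler_weXn2l // ltnW.
Qed.

(** With t = 1/h and N the size of p, p(t) is at most C t^N, while exp t exceeds t^(N+1)/(N+1)!. The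
    spare power of t yields the factor h. *)
Lemma flat_bound p : exists2 C : R, 0 <= C &
  forall h, `|h| <= 1 -> `|flat p h| <= C * `|h|.
Proof.
have [C C0 pC] := poly_bound p; pose N := size p.
exists (C * N.+1`!%:R); first by rewrite mulr_ge0.
move=> h h1; rewrite /flat; case: ifPn => [h0|_]; last by rewrite normr0 !mulr_ge0.
rewrite (gtr0_norm h0) in h1 *.
have t1 : 1 <= h^-1 by rewrite -invr1 lef_pV2 ?posrE.
have t0 : 0 < h^-1 by rewrite invr_gt0.
rewrite normrM (gtr0_norm (expR_gt0 _)) expRN ler_pdivrMr ?expR_gt0 //.
apply: le_trans (pC _ t1) _; rewrite -!mulrA ler_wpM2l // -ler_pdivrMl ?ltr0n ?fact_gt0 //.
apply: le_trans _ (ler_wpM2l (ltW h0) (expR_ge1Dxn N (ltW t0))).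
rewrite mulrDr mulr1 exprS !mulrA divff ?gt_eqF // mul1r [leLHS]mulrC.
by apply: ler_wpDl => //; exact: ltW.
Qed.

Lemma flat_gt0 y : 0 < y -> 0 < flat 1 y.
Proof. by move=> y0; rewrite /flat y0 hornerC mul1r expR_gt0. Qed.

Lemma flatXE p y : flat ('X * p) y = y^-1 * flat p y.
Proof.
rewrite /flat; case: ifP => _; last by rewrite mulr0.
by rewrite hornerM hornerX mulrA.
Qed.

Lemma is_derive_flat p y : is_derive y 1 (flat p) (flat (flat_next p) y).
Proof.
have [y0|y0|->] := ltgtP y 0.
- rewrite {2}/flat ltNge (ltW y0) /=.
  have := @is_derive_near_eq R R (fun=> 0) (flat p) y 1 0 [set z : R | z < 0].
  have o : open [set z : R | z < 0] by exact: open_lt.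
  move/(_ o y0); apply.
    by move=> z /= z0; rewrite /flat ltNge (ltW z0).
- rewrite {2}/flat y0.
  have := @is_derive_near_eq R R (fun z => p.[z^-1] * expR (- z^-1)) (flat p) y 1
    ((flat_next p).[y^-1] * expR (- y^-1)) [set z : R | 0 < z].
  have o : open [set z : R | 0 < z] by exact: open_gt.
  move/(_ o y0); apply.
    by move=> z /= z0; rewrite /flat z0.
  have y1 : y != 0 by rewrite gt_eqF.
  have dV : is_derive y 1 (fun z : R => z^-1) (- (1 * (y^-1 * y^-1))).
    exact: (@is_derive_inv _ _ id).
  have dp : is_derive y 1 (fun z => p.[z^-1]) (p^`().[y^-1] * - (1 * (y^-1 * y^-1))).
    exact: (@is_derive_comp_dir _ _ (fun z : R => z^-1) (horner p)).
  have dNV : is_derive y 1 (fun z : R => - z^-1) (- - (1 * (y^-1 * y^-1))).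
    exact: is_deriveN.
  have de : is_derive y 1 (fun z => expR (- z^-1)) (expR (- y^-1) * - - (1 * (y^-1 * y^-1))).
    exact: (@is_derive_comp_dir _ _ (fun z : R => - z^-1) expR).
  apply: (is_derive_eq (is_derive_prod dp de)).
  rewrite /flat_next hornerM hornerXn hornerD hornerN; ring.
(* At 0 the difference quotient of [flat p] is [flat ('X * p)], which tends to 0 by the linear
   bound. *)
rewrite {2}/flat ltxx; apply: cvg_is_derive.
have [C C0 HC] := flat_bound ('X * p).
have E (h : R) : h^-1 *: (flat p (h *: 1 + 0) - flat p 0) = flat ('X * p) h.
  by rewrite addr0 [h *: 1]mulr1 [flat p 0]/flat ltxx subr0 flatXE.
apply/cvgrPdist_le => e e0.
have Ce : 0 < e / (C + 1) by rewrite divr_gt0 // ltr_wpDl.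
near=> h; rewrite E sub0r normrN.
have h1 : `|h| <= 1 by near: h; apply: dnbhs0_le.
apply: le_trans (HC h h1) _.
have h2 : `|h| <= e / (C + 1) by near: h; apply: dnbhs0_le.
apply: le_trans (_ : (C + 1) * `|h| <= _); first by rewrite ler_wpM2r // lerDl.
by rewrite mulrC -ler_pdivlMr // ltr_wpDl.
Unshelve. all: by end_near. Qed.

Lemma flat_next1_gt0 y : 0 < y -> 0 < flat (flat_next 1) y.
Proof.
move=> y0; rewrite /flat y0 mulr_gt0 ?expR_gt0 // /flat_next -polyC1 derivC subr0 mulr1.
by rewrite hornerXn exprn_gt0 // invr_gt0.
Qed.

Lemma flat_le0 p y : y <= 0 -> flat p y = 0.
Proof. by rewrite /flat ltNge => ->. Qed.

(** Partial fractions: -x^2/(e^2 (e^2 - x^2)) = 1/e^2 - 1/(e^2 - x^2). The cutoff thus inherits from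
    [flat] its smoothness across x = e. *)
Lemma cutoffE (e x : R) : 0 < e -> 0 < x ->
  cutoff e x = expR (e ^- 2) * flat 1 (e ^+ 2 - x ^+ 2).
Proof.
move=> e0 x0; rewrite /cutoff /flat subr_gt0 ltr_pXn2r ?nnegrE ?ltW //.
case: ifPn => [xe|_]; last by rewrite mulr0.
rewrite hornerC mul1r -expRD; congr expR.
have : e ^+ 2 - x ^+ 2 != 0 by rewrite subr_eq0 gt_eqF // ltr_pXn2r ?nnegrE ?ltW.
have : e != 0 by rewrite gt_eqF.
by move=> h1 h2; field; rewrite h1 h2.
Qed.
End FlatFunction.

(** * Cones and fans *)

Section DotProduct.
Context {R : realType} {n : nat}.
Implicit Types (l m x y : 'rV[R]_n).

Lemma dotvE m x : dotv m x = (m *m x^T) 0 0.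
Proof. by rewrite mxE; apply: eq_bigr => k _; rewrite mxE. Qed.

Lemma dotvC m x : dotv m x = dotv x m.
Proof. by apply: eq_bigr => k _; rewrite mulrC. Qed.

Lemma dotvDr m x y : dotv m (x + y) = dotv m x + dotv m y.
Proof. by rewrite !dotvE linearD mulmxDr mxE. Qed.

Lemma dotvZr m c x : dotv m (c *: x) = c * dotv m x.
Proof. by rewrite !dotvE linearZ /= -scalemxAr mxE. Qed.

Lemma dotv0r m : dotv m 0 = 0.
Proof. by rewrite -(scale0r 0) dotvZr mul0r. Qed.

Lemma dotvNr m x : dotv m (- x) = - dotv m x.
Proof. by rewrite -scaleN1r dotvZr mulN1r. Qed.

Lemma dotvBr m x y : dotv m (x - y) = dotv m x - dotv m y.
Proof. by rewrite dotvDr dotvNr. Qed.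

Lemma dotv_sumr (I : Type) (r : seq I) (P : pred I) (F : I -> 'rV[R]_n) m :
  dotv m (\sum_(i <- r | P i) F i) = \sum_(i <- r | P i) dotv m (F i).
Proof. exact: (big_morph _ (dotvDr m) (dotv0r m)). Qed.

Lemma dotvDl x y m : dotv (x + y) m = dotv x m + dotv y m.
Proof. by rewrite dotvC dotvDr !(dotvC m). Qed.

Lemma dotvZl c x m : dotv (c *: x) m = c * dotv x m.
Proof. by rewrite dotvC dotvZr (dotvC m). Qed.

Lemma dotvNl x m : dotv (- x) m = - dotv x m.
Proof. by rewrite dotvC dotvNr (dotvC m). Qed.

Lemma dotvBl x y m : dotv (x - y) m = dotv x m - dotv y m.
Proof. by rewrite dotvDl dotvNl. Qed.

Lemma dotv_suml (I : Type) (r : seq I) (P : pred I) (F : I -> 'rV[R]_n) m :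
  dotv (\sum_(i <- r | P i) F i) m = \sum_(i <- r | P i) dotv (F i) m.
Proof. by rewrite dotvC dotv_sumr; apply: eq_bigr => i _; rewrite dotvC. Qed.

Lemma dotv_delta m k : dotv m (delta_mx 0 k) = m 0 k.
Proof.
rewrite /dotv (bigD1 k) //= big1 ?addr0 => [|j jk]; rewrite mxE eqxx ?mulr1 //=.
  by rewrite eqxx mulr1.
by rewrite (negbTE jk) mulr0.
Qed.

Lemma dotvv_ge0 x : 0 <= dotv x x.
Proof. by apply: sumr_ge0 => k _; rewrite -expr2 sqr_ge0. Qed.

Lemma dotvv_eq0 x : (dotv x x == 0) = (x == 0).
Proof.
apply/idP/eqP => [|->]; last by rewrite dotv0r.
rewrite psumr_eq0 => [/allP h|k _]; last by rewrite -expr2 sqr_ge0.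
apply/rowP => k; have := h k (mem_index_enum _).
by rewrite /= mulf_eq0 orbb mxE => /eqP.
Qed.

Lemma dotvv_gt0 x : x != 0 -> 0 < dotv x x.
Proof. by move=> x0; rewrite lt_def dotvv_eq0 x0 dotvv_ge0. Qed.

End DotProduct.

(** * Gordan's alternative for finitely many vectors *)

Section Gordan.
Context {R : realType} {n : nat}.

Lemma sumr_seq_gt0 (I : eqType) (s : seq I) (F : I -> R) j :
  (forall i, i \in s -> 0 <= F i) -> j \in s -> 0 < F j -> 0 < \sum_(i <- s) F i.
Proof.
elim: s => // i s IH F0; have F0s k : k \in s -> 0 <= F k.
  by move=> ks; apply: F0; rewrite inE ks orbT.
rewrite inE big_cons => /predU1P[->|js] Fj.
  by apply: ltr_wpDr => //; rewrite big_seq sumr_ge0.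
by apply: ltr_wpDl; [apply: F0; rewrite inE eqxx | apply: IH].
Qed.

(** Finitely many strict inequalities survive a small enough perturbation. *)
Lemma uniform_small (I : eqType) (s : seq I) (p q : I -> R) :
  (forall j, j \in s -> 0 < p j) ->
  exists2 t, 0 < t & forall j, j \in s -> 0 < p j + t * q j.
Proof.
move=> p0; suff [t t0 ht] : exists2 t, 0 < t & forall j, j \in s -> t * `|q j| < p j.
  exists t => // j js; have := ht j js.
  rewrite -(gtr0_norm t0) -normrM ltr_norml => /andP[+ _].
  by rewrite gtr0_norm // ltrNl -subr_gt0 opprK.
elim: s p0 => [|i s IH] p0; first by exists 1.
have [|t t0 ht] := IH; first by move=> j js; apply: p0; rewrite inE js orbT.
have pi : 0 < p i by apply: p0; rewrite inE eqxx.
have q1 : 0 < `|q i| + 1 by rewrite ltr_wpDl.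
exists (Num.min t (p i / (`|q i| + 1))); first by rewrite lt_min t0 divr_gt0.
move=> j; rewrite inE => /predU1P[->|js].
  apply: le_lt_trans (_ : p i / (`|q i| + 1) * `|q i| < _).
    by rewrite ler_wpM2r // ge_min lexx orbT.
  by rewrite mulrAC ltr_pdivrMr // ltr_pM2l // ltrDl.
by apply: le_lt_trans (ht j js); rewrite ler_wpM2r // ge_min lexx.
Qed.

(** Orthogonal projection onto the complement of [a]; it is the identity when [a = 0], since then
    the subtracted multiple of [a] is 0. *)
Definition project (a x : 'rV[R]_n) := x - (dotv a x / dotv a a) *: a.

Lemma dotv_projectl a x y : dotv (project a x) y = dotv x (project a y).
Proof.
rewrite /project dotvBl dotvBr dotvZl dotvZr (dotvC x a).
by congr (_ - _); rewrite mulrAC [RHS]mulrAC; congr (_ / _); rewrite mulrC.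
Qed.

Lemma project_id a : project a a = 0.
Proof.
rewrite /project; have [->|a0] := eqVneq a 0; first by rewrite scaler0 subr0.
by rewrite divff ?dotvv_eq0 // scale1r subrr.
Qed.

Lemma project_sum (I : Type) (s : seq I) (c : I -> R) (F : I -> 'rV[R]_n) a :
  \sum_(j <- s) c j *: project a (F j) = project a (\sum_(j <- s) c j *: F j).
Proof.
rewrite /project dotv_sumr mulr_suml scaler_suml -sumrB; apply: eq_bigr => j _.
by rewrite scalerBr scalerA dotvZr mulrA.
Qed.

Lemma project_eq0 a x : project a x = 0 -> exists k, x = k *: a.
Proof. by move=> /eqP; rewrite subr_eq0 => /eqP h; exists (dotv a x / dotv a a). Qed.

(* A new vector a is handled by projecting the others onto the orthogonal
   complement of a; a functional found there can be tilted towards a. *)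
Lemma gordan (I : eqType) (s : seq I) (F : I -> 'rV[R]_n) : uniq s ->
  (exists l, forall i, i \in s -> 0 < dotv l (F i)) \/
  (exists c : I -> R, [/\ forall i, 0 <= c i, exists2 i, i \in s & 0 < c i
     & \sum_(i <- s) c i *: F i = 0]).
Proof.
elim: s F => [|i s IH] F; first by left; exists 0.
move=> /= /andP[ins us].
have ext (c : I -> R) (k : R) : \sum_(j <- i :: s) (if j == i then k else c j) *: F j =
    k *: F i + \sum_(j <- s) c j *: F j.
  rewrite big_cons eqxx; congr (_ + _); rewrite big_seq [RHS]big_seq.
  by apply: eq_bigr => j js; case: eqP => // ji; rewrite -ji js in ins.
have [[l hl]|[c [c0 [j js cj] sc]]] := IH F us; last first.
  right; exists (fun j => if j == i then 0 else c j); split.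
  - by move=> k; case: ifP.
  - exists j; first by rewrite inE js orbT.
    by case: eqP => // ji; rewrite -ji js in ins.
  - by rewrite ext scale0r sc addr0.
have [a0|a0] := eqVneq (F i) 0.
  right; exists (fun j => if j == i then 1 else 0); split.
  - by move=> k; case: ifP.
  - by exists i; rewrite ?inE eqxx.
  - by rewrite (ext (fun=> 0)) a0 scaler0 add0r big1 // => j _; rewrite scale0r.
have [[l' hl']|[c [c0 [j js cj] sc]]] := IH (fun j => project (F i) (F j)) us.
  left; pose l2 := project (F i) l'.
  have [|t t0 ht] := @uniform_small _ s (fun j => dotv l2 (F j)) (fun j => dotv (F i) (F j)).
    by move=> j js; rewrite /l2 dotv_projectl hl'.
  exists (l2 + t *: F i) => j; rewrite inE dotvDl dotvZl => /predU1P[->|/ht //].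
  by rewrite /l2 dotv_projectl project_id dotv0r add0r mulr_gt0 // dotvv_gt0.
move: sc; rewrite project_sum => /project_eq0[k sc].
(* Unprojected, the relation reads: the sum of the c_j F_j equals k F_i. If k <= 0, the coefficient
   -k on F_i closes it to a relation; if k > 0, the functional [l], positive on the F_j, is positive
   on F_i too. *)
have [k0|k0] := lerP k 0.
  right; exists (fun j => if j == i then - k else c j); split.
  - by move=> h; case: ifP => // _; rewrite oppr_ge0.
  - exists j; first by rewrite inE js orbT.
    by case: eqP => // ji; rewrite -ji js in ins.
  - by rewrite ext sc scaleNr addNr.
left; exists l => h; rewrite inE => /predU1P[->|/hl //].
rewrite -(pmulr_rgt0 _ k0) -dotvZr -sc dotv_sumr.
apply: (@sumr_seq_gt0 _ _ _ j) => // [h' h's|].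
  by rewrite dotvZr mulr_ge0 // ltW // hl.
by rewrite dotvZr mulr_gt0 // hl.
Qed.

End Gordan.

(** * Irredundant generators and rays of cones *)

Section Cones.
Context {R : realType} {n : nat}.
Implicit Types (S : seq 'rV[int]_n) (s : 'rV[int]_n) (sigma : set 'rV[R]_n).

Lemma cone_of0 S : cone_of S (0 : 'rV[R]_n).
Proof. by exists (fun=> 0); split => //; rewrite big1 // => i _; rewrite scale0r. Qed.

Lemma cone_ofD S (x y : 'rV[R]_n) : cone_of S x -> cone_of S y -> cone_of S (x + y).
Proof.
move=> [c [c0 ->]] [d [d0 ->]]; exists (fun i => c i + d i); split=> [i|].
  by rewrite addr_ge0.
by rewrite -big_split; apply: eq_bigr => i _; rewrite scalerDl.
Qed.

Lemma cone_ofZ S k (x : 'rV[R]_n) : 0 <= k -> cone_of S x -> cone_of S (k *: x).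
Proof.
move=> k0 [c [c0 ->]]; exists (fun i => k * c i); split=> [i|]; first by rewrite mulr_ge0.
by rewrite scaler_sumr; apply: eq_bigr => i _; rewrite scalerA.
Qed.

Lemma cone_of_sum S (I : eqType) (r : seq I) (F : I -> 'rV[R]_n) :
  (forall i, i \in r -> cone_of S (F i)) -> cone_of S (\sum_(i <- r) F i).
Proof.
move=> h; rewrite big_seq; elim/big_rec: _ => [|i x ir]; first exact: cone_of0.
by apply: cone_ofD; apply: h.
Qed.

Lemma cone_of_mem S s : s \in S -> cone_of S (intv s : 'rV[R]_n).
Proof.
move=> sS; have iS : (index s S < size S)%N by rewrite index_mem.
exists (fun i => (i == Ordinal iS)%:R); split => //.
rewrite (bigD1 (Ordinal iS)) //= eqxx scale1r nth_index // big1 ?addr0 // => i /negbTE ->.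
by rewrite scale0r.
Qed.

Lemma cone_of_sub S S' : (forall s, s \in S -> cone_of S' (intv s : 'rV[R]_n)) ->
  cone_of S `<=` (cone_of S' : set 'rV[R]_n).
Proof.
move=> h x [c [c0 ->]]; apply: cone_of_sum => i _; apply: cone_ofZ => //.
by apply: h; rewrite mem_nth.
Qed.

Lemma cone_of1 s (x : 'rV[R]_n) : cone_of [:: s] x -> exists2 c, 0 <= c & x = c *: intv s.
Proof. by move=> [c [c0 ->]]; exists (c ord0) => //; rewrite big_ord1. Qed.

(** [rem] deletes one occurrence only, so repetitions are excluded, as is the zero vector. *)
Definition irredundant S : Prop :=
  forall s, s \in S -> ~ cone_of (rem s S) (intv s : 'rV[R]_n).

(** Take a generating sequence of least length: a redundant generator could be dropped. *)
Lemma irredundant_generators S : exists2 S' : seq 'rV[int]_n,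
  cone_of S = cone_of S' :> set 'rV[R]_n & irredundant S'.
Proof.
pose P k := exists2 S', size S' = k & cone_of S = cone_of S' :> set 'rV[R]_n.
have [|k /asboolP[S' <- SS'] kmin] := @ex_minnP (fun k => `[< P k >]).
  by exists (size S); apply/asboolP; exists S.
exists S' => // s sS cs.
have /kmin : `[< P (size (rem s S')) >].
  apply/asboolP; exists (rem s S') => //; rewrite SS'; apply/seteqP; split.
    apply: cone_of_sub => t tS; have [->//|ts] := eqVneq t s.
    by apply: cone_of_mem; apply: rem_mem.
  by apply: cone_of_sub => t /mem_rem tS; apply: cone_of_mem.
by rewrite size_rem // leqNgt ltn_predL; case: (S') sS.
Qed.

Lemma irredundant_uniq S : irredundant S -> uniq S.
Proof.
move=> irr; apply: count_mem_uniq => s.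
have [sS|/count_memPn //] := boolP (s \in S).
rewrite (seq.permP (perm_to_rem sS)) /= eqxx; rewrite add1n; congr _.+1; apply/count_memPn.
by apply/negP => sr; case: (irr s sS); apply: cone_of_mem.
Qed.

(* Modulo s the other generators lie in an open half space, by Gordan's
   alternative: a positive relation among them would contradict irredundancy or
   strong convexity. *)
Lemma irredundant_face S s : irredundant S -> strongly_convex (cone_of S : set 'rV[R]_n) ->
  s \in S -> is_face (cone_of [:: s]) (cone_of S : set 'rV[R]_n).
Proof.
move=> irr sc sS; have us := irredundant_uniq irr.
pose s0 : 'rV[R]_n := intv s.
have remS t : t \in rem s S -> t \in S by exact: mem_rem.
have [[l hl]|[c [c0 [t ts ct]]]] :=
    gordan (fun t => project s0 (intv t : 'rV[R]_n)) (rem_uniq s us); last first.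
  rewrite project_sum => /project_eq0[k ck]; have [k0|k0] := lerP k 0.
    (* For k <= 0 the relation puts the opposite of c_t t in the cone as well, so t = 0, a redundant
       generator. *)
    have t0 : c t *: intv t = 0 :> 'rV[R]_n.
      apply: sc; first by apply: cone_ofZ => //; apply: cone_of_mem; apply: remS.
      have -> : - (c t *: intv t) =
          \sum_(j <- rem t (rem s S)) c j *: intv j + (- k) *: s0 :> 'rV[R]_n.
        rewrite scaleNr -ck (perm_big _ (perm_to_rem ts)) big_cons.
        by rewrite opprD addrCA subrr addr0.
      apply: cone_ofD; last by apply: cone_ofZ; [rewrite oppr_ge0|apply: cone_of_mem].
      by apply: cone_of_sum => j /mem_rem /remS jS; apply: cone_ofZ => //; apply: cone_of_mem.
    case: (irr t (remS _ ts)); move/eqP: t0; rewrite scaler_eq0 gt_eqF //= => /eqP ->.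
    exact: cone_of0.
  (* For k > 0 dividing by k exhibits [s] as a nonnegative combination of the others. *)
  case: (irr s sS); rewrite -/s0 -[s0]scale1r -(@mulVf _ k (lt0r_neq0 k0)) -scalerA -ck.
  apply: cone_ofZ; first by rewrite invr_ge0 ltW.
  by apply: cone_of_sum => j jS; apply: cone_ofZ => //; apply: cone_of_mem.
(* The functional [m] vanishes on [s] and is positive on the other generators, so it cuts out
   exactly the ray of [s]. *)
pose m := project s0 l.
have ms0 : dotv m s0 = 0 by rewrite dotv_projectl project_id dotv0r.
have mt t : t \in S -> t != s -> 0 < dotv m (intv t).
  by move=> tS ts; rewrite dotv_projectl hl // rem_mem.
have mge0 t : t \in S -> 0 <= dotv m (intv t).
  by move=> tS; have [->|/(mt _ tS)/ltW//] := eqVneq t s; rewrite ms0.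
exists m; split.
  move=> x [c [c0 ->]]; rewrite dotv_sumr sumr_ge0 // => i _.
  by rewrite dotvZr mulr_ge0 // mge0 // mem_nth.
apply/seteqP; split => [x /cone_of1[k k0 ->]|x [[c [c0 ->]]]] /=.
  split; first by apply: cone_ofZ => //; apply: cone_of_mem.
  by rewrite /= dotvZr ms0 mulr0.
rewrite dotv_sumr => /eqP; rewrite psumr_eq0 => [/allP h|i _]; last first.
  by rewrite dotvZr mulr_ge0 // mge0 // mem_nth.
apply: cone_of_sum => i ii; have := h i ii; rewrite /= dotvZr mulf_eq0 => /orP[/eqP ->|m0].
  by rewrite scale0r; apply: cone_of0.
apply: cone_ofZ => //; apply: cone_of_mem; rewrite inE; apply: contraTT m0 => ne.
by rewrite gt_eqF // mt // mem_nth.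
Qed.

Lemma intvE s k : (intv s : 'rV[R]_n) 0 k = (s 0 k)%:~R.
Proof. by rewrite mxE. Qed.

Lemma intv_eq0 s : (intv s == 0 :> 'rV[R]_n) = (s == 0).
Proof.
apply/eqP/eqP => [/rowP h|->]; apply/rowP => k; last by rewrite !mxE.
by have := h k; rewrite !mxE => /eqP; rewrite intr_eq0 => /eqP.
Qed.

Lemma primitive_ray s : s != 0 ->
  exists u, primitive u /\ cone_of [:: s] = cone_of [:: u] :> set 'rV[R]_n.
Proof.
move=> s0; pose g := \big[gcdn/0%N]_(k < n) absz (s ord0 k).
have gs (k : 'I_n) : (g %| absz (s ord0 k))%N by rewrite (biggcdn_inf k).
have g0 : (0 < g)%N.
  rewrite lt0n; apply: contraNneq s0 => g0; apply/eqP/rowP => k; rewrite mxE.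
  by have := gs k; rewrite g0 dvd0n absz_eq0 => /eqP.
have [u us] : exists u : 'rV[int]_n, s = g%:Z *: u.
  exists (map_mx (fun a => (a %/ g%:Z)%Z) s).
  by apply/rowP => k; rewrite !mxE mulrC divzK //; exact: gs.
exists u; split.
  apply/eqP; rewrite -(eqn_pmul2l g0) muln1; apply/eqP.
  transitivity (\big[gcdn/0%N]_(k < n) (g * absz (u ord0 k))%N).
    by rewrite (big_endo (muln g)) ?muln0 //; apply: muln_gcdr.
  by apply: eq_bigr => k _; rewrite us mxE abszM.
have ius : intv s = g%:R *: intv u :> 'rV[R]_n.
  by apply/rowP => k; rewrite us !mxE intrM.
have gR : (0 : R) < g%:R by rewrite ltr0n.
apply/seteqP; split; apply: cone_of_sub => t; rewrite inE => /eqP ->.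
  by rewrite ius; apply: cone_ofZ; [exact: ltW | apply: cone_of_mem; rewrite inE].
have -> : intv u = g%:R^-1 *: intv s :> 'rV[R]_n.
  by rewrite ius scalerA mulVf ?gt_eqF // scale1r.
by apply: cone_ofZ; [rewrite invr_ge0 ltW | apply: cone_of_mem; rewrite inE].
Qed.

Lemma cone_dim_ray s : s != 0 -> cone_dim (cone_of [:: s] : set 'rV[R]_n) 1.
Proof.
rewrite -intv_eq0 => s0; exists (intv s); split.
- by rewrite /row_free rank_rV s0.
- by move=> i; rewrite row_id; apply: cone_of_mem; rewrite inE.
- by move=> x /cone_of1[c _ ->]; apply: scalemx_sub.
Qed.

End Cones.

(** * Finiteness of the lattice points of the polytope *)

Section FanLemmas.
Context {R : realType} {n : nat}.
Variables (Sigma : set (set 'rV[R]_n)) (fanSigma : complete_fan Sigma).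
Implicit Types (psi : 'rV[R]_n -> R).

Lemma ray_prim_gen (rho : set 'rV[R]_n) s : rho = cone_of [:: s] -> s != 0 ->
  rho (prim_gen rho) /\ exists2 c, 0 <= c & intv s = c *: prim_gen rho.
Proof.
move=> rs s0; have [u [pu ru]] := @primitive_ray R _ _ s0.
have Pu : [set u | primitive u /\ rho = cone_of [:: u]] u by split; rewrite // rs.
have [_ E] := xgetI 0 Pu.
rewrite /prim_gen; set v := xget _ _ in E *; split.
  by rewrite {1}E; apply: cone_of_mem; rewrite inE.
apply: cone_of1; move: E; rewrite /mkset /= => <-.
by rewrite rs; apply: cone_of_mem; rewrite inE.
Qed.

(** The polytope is defined by inequalities on rays only. Irredundant generators of the cone
    containing [x] span faces of it, hence rays of the fan, and [psi] is linear on the cone, so the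
    inequality passes to nonnegative combinations. *)
Lemma polytope_le psi m x : PL Sigma psi -> polytope Sigma psi m -> psi x <= dotv m x.
Proof.
move=> [_ plpsi] Pm; have [finS ratS faceS _ covS] := fanSigma.
have [sigma Ss sx] : (\bigcup_(sigma in Sigma) sigma) x by rewrite covS.
have [[S0 sS0] scs] := ratS _ Ss.
have [S SE irr] := @irredundant_generators R n S0.
have sS : sigma = cone_of S by rewrite sS0 SE.
have [m0 hm0] := plpsi _ Ss.
have key s : s \in S -> dotv m0 (intv s) <= dotv m (intv s).
  move=> sinS; have s0 : s != 0.
    apply/negP => s0; apply: (irr s sinS).
    by move: s0; rewrite -(@intv_eq0 R) => /eqP ->; apply: cone_of0.
  have face : is_face (cone_of [:: s]) sigma.
    by rewrite sS; apply: irredundant_face => //; rewrite -sS.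
  have [rp [c c0 ->]] := ray_prim_gen (erefl (cone_of [:: s])) s0.
  rewrite !dotvZr ler_wpM2l // -hm0; last by case: face => l [_ E]; move: rp; rewrite {1}E => -[].
  apply: Pm; split; first exact: faceS face.
  exact: cone_dim_ray.
rewrite (hm0 _ sx); move: sx; rewrite sS => -[c [c0 ->]].
by rewrite !dotv_sumr; apply: ler_sum => i _; rewrite !dotvZr ler_wpM2l // key // mem_nth.
Qed.

Lemma finite_bounded_int (B : nat) : finite_set [set u : 'rV[int]_n | forall k, (absz (u 0%R k) <= B)%N].
Proof.
apply: (@sub_finite_set _ _ ((fun w : 'rV['I_(B + B).+1]_n =>
    map_mx (fun i : 'I_(B + B).+1 => (i%:Z - B%:Z)) w) @` setT)).
  move=> u /= uB; exists (map_mx (fun a : int => inord (absz (a + B%:Z))) u) => //.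
  apply/rowP => k; have := uB k; rewrite !mxE; move: (u 0 k) => a aB.
  by rewrite inordK; lia.
by apply: finite_image; apply: finite_finset.
Qed.

(** Testing [polytope_le] on the vectors e_k and -e_k bounds every coordinate. *)
Lemma finite_lattice_points psi : PL Sigma psi -> finite_set (lattice_points Sigma psi).
Proof.
move=> pl; pose b k := `|psi (delta_mx 0 k)| + `|psi (- delta_mx 0 k)|.
pose B := Num.truncn (\sum_k b k).
apply: sub_finite_set (finite_bounded_int B) => u /= Pu k.
have h1 := polytope_le (delta_mx 0 k) pl Pu; have h2 := polytope_le (- delta_mx 0 k) pl Pu.
rewrite dotvNr in h2; rewrite dotv_delta mxE in h1 h2.
have ub : `|(u 0 k)%:~R| <= b k :> R.
  rewrite ler_norml; apply/andP; split.
    apply: le_trans h1; rewrite lerNl; apply: le_trans (ler_norm _) _.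
    by rewrite normrN lerDl.
  rewrite -lerN2; apply: le_trans h2; rewrite lerNl; apply: le_trans (ler_norm _) _.
  by rewrite normrN lerDr.
rewrite truncn_ge_nat; last by apply: sumr_ge0 => i _; rewrite addr_ge0.
rewrite -intr_norm /= in ub.
apply: le_trans (_ : b k <= _); first by rewrite natr_absz.
by rewrite (bigD1 k) //= lerDl sumr_ge0 // => i _; rewrite addr_ge0.
Qed.

End FanLemmas.

(** * Logarithmic coordinates on the torus *)

Section TorusCalculus.
Context {R : realType} {n : nat}.
Implicit Types (z v : Cn R n) (u : 'rV[int]_n) (k : 'I_n) (a b : 'rV[R]_n) (U : set (Cn R n)).

Definition sqmod k z : R := z.1 0 k ^+ 2 + z.2 0 k ^+ 2.

Lemma sqmod_eq0 k z : (sqmod k z == 0) = (coordC z k == 0).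
Proof. by rewrite /sqmod paddr_eq0 ?sqr_ge0 // !sqrf_eq0 eq_complex. Qed.

Lemma torusP z : torus z <-> forall k, sqmod k z != 0.
Proof. by split=> h k; have := h k; rewrite sqmod_eq0. Qed.

Lemma continuous_coord1 k : continuous (fun z : Cn R n => z.1 0 k : R).
Proof.
move=> z; apply: (@continuous_comp _ _ _ fst (fun x : 'rV[R]_n => x 0 k : R)).
  exact: cvg_fst.
exact: coord_continuous.
Qed.

Lemma continuous_coord2 k : continuous (fun z : Cn R n => z.2 0 k : R).
Proof.
move=> z; apply: (@continuous_comp _ _ _ snd (fun x : 'rV[R]_n => x 0 k : R)).
  exact: cvg_snd.
exact: coord_continuous.
Qed.

Lemma is_derive_linear (f : Cn R n -> R) z v :
  (forall (c : R) x y, f (c *: x + y) = c * f x + f y) -> is_derive z v f (f v).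
Proof.
move=> fl; apply: cvg_is_derive; apply/cvgrPdist_le => e e0.
near=> h; rewrite fl addrK [h^-1 *: _]mulKf; first by rewrite subrr normr0 ltW.
by near: h; exact: nbhs_dnbhs_neq.
Unshelve. all: by end_near. Qed.

Lemma is_derive_coord1 k z v : is_derive z v (fun z : Cn R n => z.1 0 k : R) (v.1 0 k).
Proof. by apply: (@is_derive_linear (fun z => z.1 0 k)) => c x y; rewrite !mxE. Qed.

Lemma is_derive_coord2 k z v : is_derive z v (fun z : Cn R n => z.2 0 k : R) (v.2 0 k).
Proof. by apply: (@is_derive_linear (fun z => z.2 0 k)) => c x y; rewrite !mxE. Qed.

Lemma Ck_coord1 U j k : open U -> Ck U j (fun z : Cn R n => z.1 0 k : R).
Proof.
move=> oU; case: j => [|j]; first by split => // z _; apply: continuous_coord1.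
apply: CkS => // [z _|v]; first exact: continuous_coord1.
by exists (fun=> v.1 0 k) => [z _|]; [exact: is_derive_coord1 | exact: Ck_cst].
Qed.

Lemma Ck_coord2 U j k : open U -> Ck U j (fun z : Cn R n => z.2 0 k : R).
Proof.
move=> oU; case: j => [|j]; first by split => // z _; apply: continuous_coord2.
apply: CkS => // [z _|v]; first exact: continuous_coord2.
by exists (fun=> v.2 0 k) => [z _|]; [exact: is_derive_coord2 | exact: Ck_cst].
Qed.

Lemma Ck_sqmod U j k : open U -> Ck U j (sqmod k).
Proof.
move=> oU; apply: (Ck_eq (f := fun z : Cn R n => z.1 0 k * z.1 0 k + z.2 0 k * z.2 0 k)) => //.
have := Ck_coord1 j k oU; have := Ck_coord2 j k oU.
by move=> C2 C1; apply: CkD => //; apply: CkM.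
Qed.

Lemma open_torus : open (@torus R n).
Proof.
have oT : open [set: Cn R n] by exact: openT.
have C : Ck [set: Cn R n] 0 (fun z => \prod_(k < n) sqmod k z).
  by apply: Ck_prod => // k; apply: Ck_sqmod.
have -> : torus = (fun z : Cn R n => \prod_(k < n) sqmod k z) @^-1` [set x | x != 0].
  apply/seteqP; split => z.
    by move/torusP => h /=; apply/prodf_neq0 => k _; apply: h.
  by move=> /= /prodf_neq0 h; apply/torusP => k; apply: h.
apply: open_comp; last exact: open_neq.
by move=> z _; apply: (Ck_continuous C).
Qed.

Lemma normc_sqr (w : R[i]) :
  ComplexField.Normc.normc w ^+ 2 = complex.Re w ^+ 2 + complex.Im w ^+ 2.
Proof. by case: w => x y /=; rewrite sqr_sqrtr // addr_ge0 ?sqr_ge0. Qed.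

Lemma normc_sqrM (w t : R[i]) : ComplexField.Normc.normc (w * t) ^+ 2 =
  ComplexField.Normc.normc w ^+ 2 * ComplexField.Normc.normc t ^+ 2.
Proof. by rewrite !normc_sqr; case: w => a b; case: t => c d; simpc => /=; ring. Qed.

Lemma normc_sqr1 : ComplexField.Normc.normc (1 : R[i]) ^+ 2 = 1.
Proof. by rewrite normc_sqr /= expr1n expr0n addr0. Qed.

Lemma normc_sqr_exprz (w : R[i]) (m : int) : ComplexField.Normc.normc (w ^ m) ^+ 2 =
  (ComplexField.Normc.normc w ^+ 2) ^ m.
Proof.
have X p : ComplexField.Normc.normc (w ^+ p) ^+ 2 = (ComplexField.Normc.normc w ^+ 2) ^+ p.
  elim: p => [|p IH]; first by rewrite !expr0 normc_sqr1.
  by rewrite (exprS w) normc_sqrM IH [RHS]exprS.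
case: m => p; first exact: X.
rewrite /exprz /=.
have V (t : R[i]) : ComplexField.Normc.normc t^-1 ^+ 2 = (ComplexField.Normc.normc t ^+ 2)^-1.
  have [->|t0] := eqVneq t 0; first by rewrite !invr0 normc_sqr /= !expr0n addr0 invr0.
  have nt0 : ComplexField.Normc.normc t ^+ 2 != 0.
    by rewrite normc_sqr paddr_eq0 ?sqr_ge0 // !sqrf_eq0; move: t0; rewrite eq_complex.
  by apply: (mulfI nt0); rewrite -normc_sqrM !divff // normc_sqr1.
by rewrite V X.
Qed.

(** A real expression in the |z_k|^2, accessible to the real differentiation rules. *)
Lemma weightE u z : weight u z = \prod_(k < n) sqmod k z ^ u 0 k.
Proof.
rewrite /weight /character (big_morph (fun w => ComplexField.Normc.normc w ^+ 2) normc_sqrM normc_sqr1).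
by apply: eq_bigr => k _; rewrite normc_sqr_exprz normc_sqr.
Qed.

Lemma weight_gt0 u z : torus z -> 0 < weight u z.
Proof.
move=> /torusP tz; rewrite weightE; apply: prodr_gt0 => k _; apply: exprz_gt0.
by rewrite lt_def tz addr_ge0 ?sqr_ge0.
Qed.

Lemma Ck_weight j u : Ck (@torus R n) j (weight u).
Proof.
have oT := open_torus.
apply: (Ck_eq (f := fun z => \prod_(k < n) sqmod k z ^ u 0 k)) => // [z _|].
  by rewrite weightE.
by apply: Ck_prod => // k; apply: Ck_exprz => // [z /torusP //|]; apply: Ck_sqmod.
Qed.

(* The tangent vector at z with logarithmic coordinates b + i a, that is with
   components z_k (b_k + i a_k). *)
Definition logvec z b a : Cn R n :=
  (\row_k (z.1 0 k * b 0 k - z.2 0 k * a 0 k), \row_k (z.1 0 k * a 0 k + z.2 0 k * b 0 k)).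

Lemma is_derive_sqmod k z b a :
  is_derive z (logvec z b a) (sqmod k) (sqmod k z * (2 * b 0 k)).
Proof.
have d1 := is_derive_coord1 k z (logvec z b a).
have d2 := is_derive_coord2 k z (logvec z b a).
apply: (is_derive_eq (is_deriveD (is_derive_prod d1 d1) (is_derive_prod d2 d2))).
by rewrite /sqmod /= !mxE; ring.
Qed.

(** Derivatives are carried as f d, with d the logarithmic derivative: powers multiply d and
    products add. *)
Lemma is_derive_log_exprn (f : Cn R n -> R) z v (d : R) (m : nat) :
  is_derive z v f (f z * d) -> is_derive z v (fun z => f z ^+ m) (f z ^+ m * (m%:R * d)).
Proof.
move=> df; elim: m => [|m IH].
  by apply: (is_derive_eq (is_derive_cst (1 : R) z v)); rewrite mul0r mulr0.
have -> : (fun z => f z ^+ m.+1) = (fun z => f z * f z ^+ m).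
  by apply/funext => w; rewrite exprS.
by apply: (is_derive_eq (is_derive_prod df IH)); rewrite exprS; ring.
Qed.

Lemma is_derive_log_exprz (f : Cn R n -> R) z v (d : R) (m : int) : f z != 0 ->
  is_derive z v f (f z * d) -> is_derive z v (fun z => f z ^ m) (f z ^ m * (m%:~R * d)).
Proof.
move=> fz df; case: m => m; first exact: is_derive_log_exprn.
have fm : f z ^+ m.+1 != 0 by rewrite expf_neq0.
have -> : (fun z => f z ^ Negz m) = (fun z => (f z ^+ m.+1)^-1) by [].
apply: (is_derive_eq (@is_derive_inv _ _ (fun z => f z ^+ m.+1) _ _ _ fm (is_derive_log_exprn m.+1 df))).
rewrite NegzE mulrNz -pmulrn (_ : f z ^ (- m.+1%:Z) = (f z ^+ m.+1)^-1) //.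
by move: (_ ^+ _) fm (m.+1%:R) => p p0 q; field.
Qed.

Lemma is_derive_log_prod (I : Type) (r : seq I) (F : I -> Cn R n -> R) z v (d : I -> R) :
  (forall i, is_derive z v (F i) (F i z * d i)) ->
  is_derive z v (fun z => \prod_(i <- r) F i z) (\prod_(i <- r) F i z * \sum_(i <- r) d i).
Proof.
move=> h; elim: r => [|i r IH].
  rewrite (_ : (fun z => \prod_(i <- [::]) F i z) = cst 1).
    by apply: (is_derive_eq (is_derive_cst (1 : R) z v)); rewrite !big_nil mulr0.
  by apply/funext => w; rewrite big_nil.
rewrite (_ : (fun z => \prod_(j <- i :: r) F j z) = fun z => F i z * \prod_(j <- r) F j z).
  by apply: (is_derive_eq (is_derive_prod (h i) IH)); rewrite !big_cons; ring.
by apply/funext => w; rewrite big_cons.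
Qed.

Lemma is_derive_weight u z b a : torus z ->
  is_derive z (logvec z b a) (weight u) (weight u z * (2 * dotv (intv u) b)).
Proof.
move=> /torusP tz; have -> : weight u = fun z => \prod_(k < n) sqmod k z ^ u 0 k.
  by apply/funext => w; rewrite weightE.
have := @is_derive_log_prod _ (index_enum 'I_n) (fun k z => sqmod k z ^ u 0 k) z
  (logvec z b a) (fun k => (u 0 k)%:~R * (2 * b 0 k)).
move=> /(_ (fun k => is_derive_log_exprz (u 0 k) (tz k) (is_derive_sqmod k z b a))) H.
apply: (is_derive_eq H); congr (_ * _); rewrite /dotv mulr_sumr; apply: eq_bigr => k _.
by rewrite mxE; ring.
Qed.

(** The form dt_k = Im(dz_k / z_k), the differential of the argument of z_k. *)
Definition angle k z v : R := (z.1 0 k * v.2 0 k - z.2 0 k * v.1 0 k) * (sqmod k z)^-1.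

Lemma angle_logvec k z b a : torus z -> angle k z (logvec z b a) = a 0 k.
Proof.
move=> /torusP /(_ k) tz; rewrite /angle /= !mxE -[RHS]mulr1 -(divff tz).
by rewrite [in RHS]mulrA; congr (_ / _); rewrite /sqmod; ring.
Qed.

Lemma Ck_angle j k v : Ck (@torus R n) j (fun z => angle k z v).
Proof.
have oT := open_torus.
have C1 := Ck_coord1 j k oT; have C2 := Ck_coord2 j k oT.
apply: CkM => //; last by apply: CkV => // [z /torusP //|]; apply: Ck_sqmod.
by apply: CkB => //; apply: CkM => //; apply: Ck_cst.
Qed.

(** The second vector is frozen while the base point moves, so the derivative of v_k / w_k is minus
    the product of the two logarithmic components; this is its imaginary part, symmetric in the two
    vectors. *)
Lemma is_derive_angle k z b0 a0 b1 a1 : torus z ->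
  is_derive z (logvec z b0 a0) (fun w => angle k w (logvec z b1 a1))
    (- (a0 0 k * b1 0 k + b0 0 k * a1 0 k)).
Proof.
move=> /torusP /(_ k) tz; set v := logvec z b1 a1.
have d1 := is_derive_coord1 k z (logvec z b0 a0).
have d2 := is_derive_coord2 k z (logvec z b0 a0).
have dn : is_derive z (logvec z b0 a0) (fun w => w.1 0 k * v.2 0 k - w.2 0 k * v.1 0 k)
   ((logvec z b0 a0).1 0 k * v.2 0 k - (logvec z b0 a0).2 0 k * v.1 0 k).
  have e1 := is_derive_prod d1 (is_derive_cst (v.2 0 k) z (logvec z b0 a0)).
  have e2 := is_derive_prod d2 (is_derive_cst (v.1 0 k) z (logvec z b0 a0)).
  by apply: (is_derive_eq (is_deriveB e1 e2)); rewrite !mulr0 !add0r.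
apply: (is_derive_eq (is_derive_prod dn (is_derive_inv tz (is_derive_sqmod k z b0 a0)))).
rewrite /= !mxE; move: tz; rewrite /sqmod => tz; field.
exact: tz.
Qed.

End TorusCalculus.

(** * The moment map and theta *)

Section Moment.
Context {R : realType} {n : nat}.
Variables (Sigma : set (set 'rV[R]_n)) (psi : 'rV[R]_n -> R).
Implicit Types (z v : Cn R n) (u : 'rV[int]_n) (k : 'I_n) (a b : 'rV[R]_n).

Local Notation LP := (lattice_points Sigma psi).
Local Notation L := (fset_set LP).
Local Notation mu := (moment_map Sigma psi).
Local Notation W := (total_weight Sigma psi).

Hypothesis finLP : finite_set LP.
Hypothesis neLP : exists u, LP u.

Lemma mem_L u : (u \in L) <-> LP u.
Proof. by rewrite in_fset_set // in_setE. Qed.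

Lemma total_weightE z : W z = \sum_(u <- L) weight u z.
Proof. exact: fsbig_finite. Qed.

Lemma total_weight_gt0 z : torus z -> 0 < W z.
Proof.
move=> tz; have [u /mem_L uL] := neLP; rewrite total_weightE.
by apply: sumr_seq_gt0 uL _ => [t _|]; [apply: ltW|]; apply: weight_gt0.
Qed.

Lemma moment_coordE z k : mu z 0 k = (\sum_(u <- L) (u 0 k)%:~R * weight u z) / W z.
Proof.
rewrite /moment_map fsbig_finite //= mxE summxE mulrC; congr (_ / _).
by apply: eq_bigr => u _; rewrite !mxE mulrC.
Qed.

Lemma dotv_moment z x : torus z ->
  dotv (mu z) x * W z = \sum_(u <- L) weight u z * dotv (intv u) x.
Proof.
move=> /total_weight_gt0/lt0r_neq0 Wz.
rewrite /moment_map fsbig_finite //= dotvZl mulrAC mulVf // mul1r dotv_suml.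
by apply: eq_bigr => u _; rewrite dotvZl.
Qed.

Lemma Ck_total_weight j : Ck (@torus R n) j W.
Proof.
have oT := @open_torus R n.
apply: (Ck_eq (f := fun z => \sum_(u <- L) weight u z)) => // [z _|].
  by rewrite total_weightE.
by apply: Ck_sum => // u; apply: Ck_weight.
Qed.

Lemma Ck_moment j k : Ck (@torus R n) j (fun z => mu z 0 k).
Proof.
have oT := @open_torus R n.
apply: (Ck_eq (f := fun z => (\sum_(u <- L) (u 0 k)%:~R * weight u z) * (W z)^-1)) => //.
  by move=> z _; rewrite moment_coordE.
apply: CkM => //; last first.
  by apply: CkV => // [z /total_weight_gt0/lt0r_neq0 //|]; apply: Ck_total_weight.
by apply: Ck_sum => // u; apply: CkM => //; [exact: Ck_cst | exact: Ck_weight].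
Qed.

(** Twice the covariance matrix of the lattice points under the probabilities |chi^u|^2 / W. It is
    the derivative of mu in the coordinates x_k = log |z_k|, acting on row vectors from the
    right. *)
Definition moment_jacobian z : 'M[R]_n := \matrix_(j, k)
  (2 / W z * \sum_(u <- L) weight u z * (u 0 j)%:~R * ((u 0 k)%:~R - mu z 0 k)).

Lemma moment_jacobianE z b k : (b *m moment_jacobian z) 0 k =
  2 / W z * \sum_(u <- L) weight u z * dotv (intv u) b * ((u 0 k)%:~R - mu z 0 k).
Proof.
rewrite mxE; under eq_bigr => j _ do rewrite mxE mulrCA mulr_sumr.
rewrite -mulr_sumr exchange_big /=; congr (_ * _); apply: eq_bigr => u _.
rewrite /dotv mulr_sumr mulr_suml; apply: eq_bigr => j _; rewrite intvE; ring.
Qed.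

Lemma is_derive_moment z b a k : torus z ->
  is_derive z (logvec z b a) (fun w => mu w 0 k) ((b *m moment_jacobian z) 0 k).
Proof.
move=> tz; have W0 := lt0r_neq0 (total_weight_gt0 tz).
have dw u := is_derive_weight u b a tz.
have dW : is_derive z (logvec z b a) W (\sum_(u <- L) weight u z * (2 * dotv (intv u) b)).
  rewrite (_ : W = fun z => \sum_(u <- L) weight u z).
    exact: is_derive_bigsum.
  by apply/funext => w; rewrite total_weightE.
have dS : is_derive z (logvec z b a) (fun w => \sum_(u <- L) (u 0 k)%:~R * weight u w)
    (\sum_(u <- L) (u 0 k)%:~R * (weight u z * (2 * dotv (intv u) b))).
  by apply: is_derive_bigsum.
rewrite (_ : (fun w => _) = fun w => (\sum_(u <- L) (u 0 k)%:~R * weight u w) * (W w)^-1).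
  apply: (is_derive_eq (is_derive_prod dS (is_derive_inv W0 dW))).
  rewrite moment_jacobianE.
  have -> : \sum_(u <- L) weight u z * dotv (intv u) b * ((u 0 k)%:~R - mu z 0 k) =
    \sum_(u <- L) (u 0 k)%:~R * (weight u z * dotv (intv u) b) -
    mu z 0 k * \sum_(u <- L) weight u z * dotv (intv u) b.
    by rewrite mulr_sumr -sumrB; apply: eq_bigr => u _; ring.
  have E1 : \sum_(u <- L) (u 0 k)%:~R * (weight u z * (2 * dotv (intv u) b)) =
     2 * \sum_(u <- L) (u 0 k)%:~R * (weight u z * dotv (intv u) b).
    by rewrite mulr_sumr; apply: eq_bigr => u _; ring.
  have E2 : \sum_(u <- L) weight u z * (2 * dotv (intv u) b) =
     2 * \sum_(u <- L) weight u z * dotv (intv u) b.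
    by rewrite mulr_sumr; apply: eq_bigr => u _; ring.
  rewrite E1 E2 moment_coordE.
  move: (\sum_(u <- L) (u 0 k)%:~R * weight u z) => A.
  move: (\sum_(u <- L) (u 0 k)%:~R * (weight u z * dotv (intv u) b)) => B.
  move: (\sum_(u <- L) weight u z * dotv (intv u) b) W0 => C.
  by move: (W z) => w w0; field.
by apply/funext => w; rewrite moment_coordE.
Qed.

(** The quadratic form of the matrix at [b] is twice the variance of <u, b>. All weights being
    positive, it vanishes only if <u, b> is constant on the lattice points. *)
Lemma moment_jacobian_unit z : torus z ->
  (forall b (c : R), (forall u, LP u -> dotv (intv u) b = c) -> b = 0) ->
  moment_jacobian z \in unitmx.
Proof.
move=> tz spanLP; have W0 := total_weight_gt0 tz.
rewrite -row_free_unit; apply: inj_row_free => b bM.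
have E : dotv (b *m moment_jacobian z) b =
    2 / W z * \sum_(u <- L) weight u z * (dotv (intv u) b - dotv (mu z) b) ^+ 2.
  (* The centred variable has mean 0, so centring the other factor too changes nothing. *)
  have S0 : \sum_(u <- L) weight u z * (dotv (intv u) b - dotv (mu z) b) = 0.
    have -> : \sum_(u <- L) weight u z * (dotv (intv u) b - dotv (mu z) b) =
        \sum_(u <- L) weight u z * dotv (intv u) b - dotv (mu z) b * \sum_(u <- L) weight u z.
      by rewrite mulr_sumr -sumrB; apply: eq_bigr => u _; ring.
    by rewrite -dotv_moment // -total_weightE subrr.
  have -> : \sum_(u <- L) weight u z * (dotv (intv u) b - dotv (mu z) b) ^+ 2 =
      \sum_(u <- L) weight u z * dotv (intv u) b * (dotv (intv u) b - dotv (mu z) b)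
      - dotv (mu z) b * \sum_(u <- L) weight u z * (dotv (intv u) b - dotv (mu z) b).
    by rewrite mulr_sumr -sumrB; apply: eq_bigr => u _; ring.
  rewrite S0 mulr0 subr0; transitivity (\sum_(k < n) 2 / W z * \sum_(u <- L)
      weight u z * dotv (intv u) b * ((u 0 k)%:~R - mu z 0 k) * b 0 k).
    apply: eq_bigr => k _; rewrite moment_jacobianE.
    by rewrite -[LHS]mulrA -mulr_suml mulrA.
  rewrite -mulr_sumr exchange_big /=; congr (_ * _); apply: eq_bigr => u _.
  rewrite -/(dotv (intv u) b) -/(dotv (mu z) b) -dotvBl; move: (mu z) (dotv _ b) => m d.
  by rewrite /dotv mulr_sumr; apply: eq_bigr => k _; rewrite !mxE; ring.
move: E; rewrite bM dotvC dotv0r => /esym/eqP.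
rewrite mulf_eq0 gt_eqF ?divr_gt0 //= big_seq psumr_eq0; last first.
  by move=> u _; rewrite mulr_ge0 ?sqr_ge0 // ltW // weight_gt0.
move=> /allP h; apply: (spanLP _ (dotv (mu z) b)) => u /mem_L uL.
have := h u uL; rewrite uL /= mulf_eq0 gt_eqF ?weight_gt0 //= sqrf_eq0 subr_eq0.
by move/eqP.
Qed.

(** Here dz_k/z_k minus its conjugate is 2i dt_k, which the factor -i/2 turns into dt_k. *)
Lemma thetaE z v : theta Sigma psi z v = \sum_(k < n) mu z 0 k * angle k z v.
Proof.
have E (c : R) (w : R[i]) :
    real_complex R c * (w - conjc w) = Complex 0 (c * (complex.Im w *+ 2)).
  by case: w => x y; rewrite /real_complex_def /=; simpc; rewrite mulr2n.
have S (F : 'I_n -> R) :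
    \sum_k Complex 0 (F k) = Complex 0 (\sum_k F k) :> R[i].
  by elim/big_rec2: _ => // k y1 y2 _ ->; simpc.
rewrite /theta /thetaC (eq_bigr (fun k => Complex 0 (mu z 0 k * (angle k z v *+ 2)))).
  rewrite S; have -> : Complex 0 1 / 2 = Complex 0 (2^-1) :> R[i].
    rewrite -[2]/(2%:R) -(rmorph_nat (real_complex R)) -fmorphV.
    by rewrite /real_complex_def /=; simpc.
  by simpc => /=; rewrite mulr_sumr; apply: eq_bigr => k _; field.
move=> k _; rewrite -conjc_inv -rmorphM E; congr (Complex 0 (_ * (_ *+ 2))).
  by rewrite moment_coordE fsbig_finite.
by rewrite /angle /sqmod /coordC /=; ring.
Qed.

Lemma smooth_theta : smooth_one_form_on (@torus R n) (theta Sigma psi).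
Proof.
have oT := @open_torus R n; split.
  move=> z _ c v w; rewrite !thetaE mulr_sumr -big_split; apply: eq_bigr => k _ /=.
  by rewrite /angle /= !mxE; ring.
move=> v; apply: Ck_smooth_on => j.
apply: (Ck_eq (f := fun z => \sum_(k < n) mu z 0 k * angle k z v)) => // [z _|].
  by rewrite thetaE.
by apply: Ck_sum => // k; apply: CkM => //; [exact: Ck_moment | exact: Ck_angle].
Qed.

Lemma theta_logvec z b a : torus z -> theta Sigma psi z (logvec z b a) = dotv (mu z) a.
Proof. by move=> tz; rewrite thetaE; apply: eq_bigr => k _; rewrite angle_logvec. Qed.

Lemma derive_theta z b0 a0 b1 a1 : torus z ->
  'D_(logvec z b0 a0) (fun w => theta Sigma psi w (logvec z b1 a1)) z =
  dotv (b0 *m moment_jacobian z) a1 -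
  \sum_(k < n) mu z 0 k * (a0 0 k * b1 0 k + b0 0 k * a1 0 k).
Proof.
move=> tz; set v := logvec z b1 a1.
have H k := is_derive_prod (is_derive_moment b0 a0 k tz) (is_derive_angle k b0 a0 b1 a1 tz).
have [_ D] := is_derive_bigsum (index_enum 'I_n) H.
rewrite (_ : (fun w => _) = fun w => \sum_(k < n) mu w 0 k * angle k w v); last first.
  by apply/funext => w; rewrite thetaE.
rewrite D /dotv -sumrB; apply: eq_bigr => k _.
by rewrite angle_logvec //; ring.
Qed.

(** The terms from differentiating the angle forms are symmetric in the two frozen vectors and
    cancel, leaving the sum of the dmu_k /\ dt_k. *)
Lemma ext_d_theta z (B A : 'I_2 -> 'rV[R]_n) : torus z ->
  ext_d (theta Sigma psi) z (fun i => logvec z (B i) (A i)) =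
  dotv (B ord0 *m moment_jacobian z) (A ord_max) -
  dotv (B ord_max *m moment_jacobian z) (A ord0).
Proof.
move=> tz; rewrite /ext_d !derive_theta //.
have -> : \sum_(k < n) mu z 0 k * (A ord0 0 k * B ord_max 0 k + B ord0 0 k * A ord_max 0 k) =
    \sum_(k < n) mu z 0 k * (A ord_max 0 k * B ord0 0 k + B ord_max 0 k * A ord0 0 k).
  by apply: eq_bigr => k _; ring.
ring.
Qed.

End Moment.

(** * The polyhedral Hamiltonian *)

Section Hamiltonian.
Context {R : realType} {n : nat}.
Variables (Sigma : set (set 'rV[R]_n)) (psi : 'rV[R]_n -> R) (eps : set 'rV[R]_n -> R).
Implicit Types (z v : Cn R n) (u : 'rV[int]_n) (k : 'I_n) (a b : 'rV[R]_n)
  (rho : set 'rV[R]_n).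

Local Notation LP := (lattice_points Sigma psi).
Local Notation mu := (moment_map Sigma psi).
Local Notation W := (total_weight Sigma psi).
Local Notation rays := (fset_set (cones Sigma 1)).
Local Notation H := (hamiltonian Sigma psi eps).

Hypothesis finLP : finite_set LP.
Hypothesis neLP : exists u, LP u.
Hypothesis spanLP : forall b (c : R), (forall u, LP u -> dotv (intv u) b = c) -> b = 0.
Hypothesis finSigma : finite_set Sigma.
Hypothesis psi_neg : forall rho, cones Sigma 1 rho -> psi (prim_gen rho) < 0.
Hypothesis eps_gt0 : forall rho, cones Sigma 1 rho -> 0 < eps rho.
Hypothesis eps_lt : forall rho, cones Sigma 1 rho -> eps rho < - psi (prim_gen rho).

Lemma finite_rays : finite_set (cones Sigma 1).
Proof. by apply: sub_finite_set finSigma => rho []. Qed.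

Lemma mem_rays rho : (rho \in rays) <-> cones Sigma 1 rho.
Proof. by rewrite in_fset_set ?in_setE //; exact: finite_rays. Qed.

(** The slack of mu is a mean, with positive weights, of the nonnegative slacks of lattice points.
    If all of these vanished, [spanLP] would give u_rho = 0, hence psi(u_rho) = 0, against
    [psi_neg]. *)
Lemma slack_gt0 z rho : torus z -> cones Sigma 1 rho -> 0 < slack psi rho (mu z).
Proof.
move=> tz rayr; have W0 := total_weight_gt0 finLP neLP tz; set x := prim_gen rho.
rewrite -(pmulr_lgt0 _ W0) /slack mulrBl dotv_moment //.
rewrite [X in _ - _ * X]total_weightE // mulr_sumr -sumrB.
have [[u LPu ux]|h] := pselect (exists2 u, LP u & psi x < dotv (intv u) x).
  apply: (@sumr_seq_gt0 _ _ _ _ u) => [t /mem_L-/(_ finLP) LPt||]; first 2 last.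
  - by rewrite mulrC -mulrBl mulr_gt0 ?weight_gt0 // subr_gt0.
  - by rewrite mulrC -mulrBl mulr_ge0 ?(ltW (weight_gt0 _ _)) // subr_ge0; apply: LPt.
  - exact/mem_L.
have E u : LP u -> dotv (intv u) x = psi x.
  move=> LPu; apply/eqP; rewrite eq_le [X in _ && X](LPu _ rayr) andbT leNgt.
  by apply/negP => ux; apply: h; exists u.
have x0 := spanLP E; have [u LPu] := neLP.
by have := psi_neg rayr; rewrite -/x -(E u LPu) x0 dotv0r ltxx.
Qed.

Lemma Ck_slack j rho : Ck (@torus R n) j (fun z => slack psi rho (mu z)).
Proof.
have oT := @open_torus R n; apply: CkB => //; last exact: Ck_cst.
by apply: Ck_sum => // k; apply: CkM => //; [exact: Ck_moment | exact: Ck_cst].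
Qed.

Lemma is_derive_slack rho z b a : torus z ->
  is_derive z (logvec z b a) (fun z => slack psi rho (mu z))
    (dotv (b *m moment_jacobian Sigma psi z) (prim_gen rho)).
Proof.
move=> tz; have dm k := is_derive_moment finLP neLP b a k tz.
have d k := is_derive_prod (dm k) (is_derive_cst (prim_gen rho 0 k) z (logvec z b a)).
have D := is_derive_bigsum (index_enum 'I_n) d.
apply: (is_derive_eq (is_deriveB D (is_derive_cst (psi (prim_gen rho)) z (logvec z b a)))).
by rewrite subr0; apply: eq_bigr => k _; rewrite mulr0 add0r.
Qed.

Lemma hamiltonianE z : torus z -> H z = \sum_(rho <- rays)
  expR (eps rho ^- 2) * flat 1 (eps rho ^+ 2 - slack psi rho (mu z) * slack psi rho (mu z)).
Proof.
move=> tz; rewrite /hamiltonian /hamiltonian_base fsbig_finite /=; last exact: finite_rays.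
rewrite big_seq [RHS]big_seq; apply: eq_bigr => rho /mem_rays rayr.
by rewrite cutoffE ?slack_gt0 ?eps_gt0 // expr2.
Qed.

Lemma Ck_hamiltonian j : Ck (@torus R n) j H.
Proof.
have oT := @open_torus R n.
apply: (Ck_eq oT (fun z tz => esym (hamiltonianE tz))).
apply: Ck_sum => // rho; apply: CkM => //; first exact: Ck_cst.
apply: (@Ck_comp_family _ _ _ _ _ _ (@flat R) (@flat_next R)) => //; last exact: is_derive_flat.
apply: CkB => //; first exact: Ck_cst.
by apply: CkM => //; apply: Ck_slack.
Qed.

(** The derivative of the cutoff of [rho] with respect to its slack. *)
Definition ray_slope rho z : R := expR (eps rho ^- 2) *
  flat (flat_next 1) (eps rho ^+ 2 - slack psi rho (mu z) * slack psi rho (mu z)) *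
  (- (2 * slack psi rho (mu z))).

Definition base_gradient z : 'rV[R]_n :=
  \sum_(rho <- rays) ray_slope rho z *: prim_gen rho.

Lemma is_derive_hamiltonian z b a : torus z ->
  is_derive z (logvec z b a) H
    (dotv (b *m moment_jacobian Sigma psi z) (base_gradient z)).
Proof.
move=> tz; set v := logvec z b a.
have d rho : is_derive z v (fun w => expR (eps rho ^- 2) *
    flat 1 (eps rho ^+ 2 - slack psi rho (mu w) * slack psi rho (mu w)))
  (ray_slope rho z * dotv (b *m moment_jacobian Sigma psi z) (prim_gen rho)).
  have ds := is_derive_slack rho b a tz.
  have d1 := is_deriveB (is_derive_cst (eps rho ^+ 2) z v) (is_derive_prod ds ds).
  have d2 := is_derive_comp_dir d1 (is_derive_flat 1 _).
  apply: (is_derive_eq (is_derive_prod (is_derive_cst (expR (eps rho ^- 2)) z v) d2)).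
  by rewrite /ray_slope /=; ring.
have D := is_derive_bigsum rays d.
have E w : torus w -> \sum_(rho <- rays) expR (eps rho ^- 2) * flat 1
   (eps rho ^+ 2 - slack psi rho (mu w) * slack psi rho (mu w)) = H w.
  by move=> tw; rewrite hamiltonianE.
apply: (is_derive_near_eq (@open_torus R n) tz E).
apply: (is_derive_eq D); rewrite /base_gradient dotv_sumr.
by apply: eq_bigr => rho _; rewrite dotvZr.
Qed.

(* Only rays with slack below eps contribute, and there
   <mu, u_rho> = slack + psi(u_rho) < eps + psi(u_rho) < 0. *)
Lemma moment_gradient_gt0 z : torus z -> 0 < H z -> 0 < dotv (mu z) (base_gradient z).
Proof.
move=> tz H0; rewrite /base_gradient dotv_sumr.
have term rho : cones Sigma 1 rho -> let s := slack psi rho (mu z) in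
  0 <= dotv (mu z) (ray_slope rho z *: prim_gen rho) /\
  (0 < flat 1 (eps rho ^+ 2 - s * s) -> 0 < dotv (mu z) (ray_slope rho z *: prim_gen rho)).
  move=> rayr s; have s0 : 0 < s by exact: slack_gt0.
  rewrite dotvZr; have [le0|gt0] := lerP (eps rho ^+ 2 - s * s) 0.
    by rewrite /ray_slope -/s !(flat_le0 _ le0) mulr0 !mul0r ltxx.
  suff : 0 < ray_slope rho z * dotv (mu z) (prim_gen rho) by move=> h; split=> //; exact: ltW.
  have es : s < eps rho.
    move: gt0; rewrite subr_gt0 -expr2 ltr_pXn2r // nnegrE ltW //; exact: eps_gt0.
  have m0 : dotv (mu z) (prim_gen rho) < 0.
    have -> : dotv (mu z) (prim_gen rho) = s + psi (prim_gen rho) by rewrite /s /slack subrK.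
    by have := eps_lt rayr; rewrite -ltrBrDr sub0r; apply: lt_trans.
  (* Both factors are negative: the pairing by [m0], the slope since the cutoff decreases. *)
  rewrite nmulr_lgt0 // /ray_slope -/s pmulr_rlt0; last first.
    by rewrite mulr_gt0 ?expR_gt0 // flat_next1_gt0.
  by rewrite oppr_lt0 mulr_gt0.
move: H0; rewrite hamiltonianE // => H0.
(* Positivity of H provides a ray with nonzero cutoff, whose term makes the sum strictly
   positive. *)
have [rho rr fr] : exists2 rho, rho \in rays &
    0 < flat 1 (eps rho ^+ 2 - slack psi rho (mu z) * slack psi rho (mu z)).
  apply: contrapT => h; move: H0; rewrite big_seq big1 ?ltxx // => rho rr.
  have [le0|gt0] := lerP (eps rho ^+ 2 - slack psi rho (mu z) * slack psi rho (mu z)) 0.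
    by rewrite flat_le0 // mulr0.
  by case: h; exists rho => //; apply: flat_gt0.
apply: (@sumr_seq_gt0 _ _ _ _ rho) => // [t /mem_rays /term[]//|].
by have [_] := term _ (iffLR (mem_rays rho) rr); apply.
Qed.

(** The direction is that of the Liouville field: b = mu M^-1 moves mu radially, so that H varies at
    the rate <mu, grad h>. *)
Lemma hamiltonian_increasing_direction z : torus z -> 0 < H z ->
  exists2 v, is_derive z v H ('D_v H z) & 0 < 'D_v H z.
Proof.
move=> tz H0; have Mu := moment_jacobian_unit finLP neLP tz spanLP.
pose b := mu z *m invmx (moment_jacobian Sigma psi z).
have [d E] := is_derive_hamiltonian b 0 tz.
exists (logvec z b 0); first exact: derivableP.
by rewrite E /b mulmxKV // moment_gradient_gt0.
Qed.

Variables (delta : R) (delta_gt0 : 0 < delta).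

Local Notation S := (level Sigma psi eps delta).

Lemma level_local_equation z : S z -> local_equation S z (fun w => H w - delta).
Proof.
move=> [tz Hz]; have oT := @open_torus R n; exists torus; split => //.
- apply: Ck_smooth_on => j; apply: CkB => //; [exact: Ck_hamiltonian | exact: Ck_cst].
- apply/seteqP; split => w /=.
    by move=> [[tw Hw] _]; split => //; rewrite Hw subrr.
  by move=> [tw /eqP]; rewrite subr_eq0 => /eqP Hw.
have [|v [dv _] Dv] := hamiltonian_increasing_direction tz; first by rewrite Hz.
by exists v; rewrite deriveB // [X in _ - X](derive_cst delta) subr0 gt_eqF.
Qed.

(** H depends only on the moduli of the coordinates, so [a] is unconstrained. *)
Lemma tangent_logvec z b a : S z ->
  dotv (b *m moment_jacobian Sigma psi z) (base_gradient z) = 0 ->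
  tangent_space S z (logvec z b a).
Proof.
move=> Sz h; exists (fun w => H w - delta); first exact: level_local_equation.
have [d E] := is_derive_hamiltonian b a (proj1 Sz).
by rewrite deriveB // [X in _ - X](derive_cst delta) subr0 E.
Qed.

(** Off the level, the strict inequality persists nearby by continuity. On the level, an increasing
    direction leads out of the sublevel set, so the point is not interior. *)
Lemma boundary_sublevel : boundary_in torus (sublevel Sigma psi eps delta) = S.
Proof.
have oT := @open_torus R n.
have cH z : torus z -> {for z, continuous H} by exact: (Ck_continuous (Ck_hamiltonian 0)).
apply/seteqP; split => z.
  move=> [tz [cz nz]]; split => //; have nT : nbhs z torus by apply: open_nbhs_nbhs.
  have [lt|gt|//] := ltgtP (H z) delta.
    case: nz; rewrite /interior /=.
    have : \forall w \near z, H w < delta by exact: (cH z tz [set y | y < delta] (lt_nbhsl lt)).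
    by apply: filterS2 nT => w tw /ltW.
  have : \forall w \near z, delta < H w by exact: (cH z tz [set y | delta < y] (lt_nbhsr gt)).
  by move=> /cz [w [[_ /le_lt_trans h] /h]]; rewrite ltxx.
move=> [tz Hz]; split => //; split.
  by apply: subset_closure; split => //; rewrite Hz.
rewrite /interior /= => nW.
have [|v dv Dv] := hamiltonian_increasing_direction tz; first by rewrite Hz.
have cv := is_derive_cvg dv.
have line : (fun h : R => h *: v + z) @ 0^' --> z.
  have : {for (0 : R), continuous (fun h : R => h *: v + z)}.
    apply: (@continuousD _ _ _ (fun h : R => h *: v) (cst z)).
      exact: scalel_continuous.
    exact: cvg_cst.
  move=> /continuous_withinNx; by rewrite scale0r add0r.
(* On right neighbourhoods h > 0, so the difference quotient has the sign of the increment. *)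
have right (P : R -> Prop) : (\forall h \near 0^', P h) -> \forall h \near 0^'+, P h.
  move=> nP; apply: (@filterS _ (nbhs (0 : R)) _ _ _ _ nP) => h hP h0; apply: hP.
  by rewrite gt_eqF.
have n1 : \forall h \near 0^'+, H (h *: v + z) <= delta.
  by apply: right; apply: (@filterS _ ((0 : R)^') _ _ _ _ (line _ nW)) => h [].
have n2 : \forall h \near 0^'+, 0 < h^-1 *: (H (h *: v + z) - H z).
  by apply: right; exact: (cv [set y | 0 < y] (lt_nbhsr Dv)).
near (0 : R)^'+ => h.
have h0 : 0 < h by near: h; apply: nbhs_right_gt.
have h1 : H (h *: v + z) <= delta by near: h.
have : 0 < h^-1 *: (H (h *: v + z) - H z) by near: h.
by rewrite [_ *: _]/(_ * _) pmulr_rgt0 ?invr_gt0 // Hz subr_gt0 ltNge h1.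
Unshelve. all: by end_near. Qed.

End Hamiltonian.

(** * The contact condition *)

Section Contact.
Context {R : realType}.

(** When <m, g> is nonzero, the orthogonal complements of g and m are in perfect duality. With g_p
    nonzero, basis vectors are corrected by e_p to be orthogonal to g, and by g to be orthogonal to
    m; the latter correction is invisible to the Y_i. *)
Lemma dual_families n (g m : 'rV[R]_n.+1) : dotv m g != 0 ->
  exists Y Z : 'I_n -> 'rV[R]_n.+1, [/\ forall i, dotv (Y i) g = 0,
    forall i, dotv m (Z i) = 0 & forall i j, dotv (Y i) (Z j) = (i == j)%:R].
Proof.
move=> c0; have [p gp] : exists p, g 0 p != 0.
  apply: contrapT => h; move/eqP: c0; apply; apply: big1 => k _.
  have [->|gk] := eqVneq (g 0 k) 0; first by rewrite mulr0.
  by case: h; exists k.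
pose e k : 'rV[R]_n.+1 := delta_mx 0 k.
pose Y i := e (lift p i) - (g 0 (lift p i) / g 0 p) *: e p.
pose Z i := e (lift p i) - (m 0 (lift p i) / dotv m g) *: g.
have Yg i : dotv (Y i) g = 0.
  by rewrite dotvBl dotvZl !(dotvC (e _)) !dotv_delta mulfVK // subrr.
exists Y, Z; split => // [i|i j].
  by rewrite dotvBr dotvZr dotv_delta mulfVK // subrr.
rewrite dotvBr dotvZr Yg mulr0 subr0 dotv_delta !mxE !eqxx /=.
rewrite (inj_eq lift_inj) eq_sym [_ == p]eq_sym (negbTE (neq_lift _ _)) mulr0 subr0.
by [].
Qed.

Lemma half_ltn2 n (x : 'I_(n * 2)) : (x./2 < n)%N.
Proof. by have := ltn_ord x; lia. Qed.

Definition half_ord n (x : 'I_(n * 2)) : 'I_n := Ordinal (half_ltn2 x).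

(** The first vector, [logvec z 0 g], spans the Reeb line: d theta pairs it to 0 with every vector
    satisfying the tangency condition, and theta takes the value <mu, g> > 0 on it. The others form
    a symplectic family in the kernel of theta. *)
Lemma wedge_theta_neq0 n (Sigma : set (set 'rV[R]_n)) psi z (g : 'rV[R]_n) : (0 < n)%N ->
  finite_set (lattice_points Sigma psi) -> (exists u, lattice_points Sigma psi u) ->
  torus z -> moment_jacobian Sigma psi z \in unitmx ->
  0 < dotv (moment_map Sigma psi z) g ->
  exists v : 'I_(1 + n.-1 * 2) -> Cn R n,
    (forall i, exists b a, v i = logvec z b a /\ dotv (b *m moment_jacobian Sigma psi z) g = 0) /\
    wedge (form1 (theta Sigma psi) z) (wedge_pow2 (ext_d (theta Sigma psi) z) n.-1) v != 0.
Proof.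
case: n Sigma psi z g => // n Sigma psi z g _ finLP neLP tz Mu c0 /=.
set M := moment_jacobian Sigma psi z in Mu *.
have [Y [Z [Yg mZ YZ]]] := dual_families (lt0r_neq0 c0).
(* Even indices move mu along Y_i at fixed angles; odd ones rotate the angles along Z_i at fixed
   mu. *)
pose B (x : 'I_(n * 2)) := if odd x then 0 else Y (half_ord x) *m invmx M.
pose A (x : 'I_(n * 2)) := if odd x then Z (half_ord x) else 0.
pose v (i : 'I_(n * 2).+1) : Cn R n.+1 :=
  if unlift ord0 i is Some x then logvec z (B x) (A x) else logvec z 0 g.
have BM x : B x *m M = if odd x then 0 else Y (half_ord x).
  by rewrite /B; case: ifP; rewrite ?mul0mx // mulmxKV.
exists v; split.
  move=> i; rewrite /v; case: unlift => [x|].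
    exists (B x), (A x); split => //; rewrite BM; case: ifP => _; last exact: Yg.
    by rewrite dotvC dotv0r.
  by exists 0, g; rewrite mul0mx dotvC dotv0r.
rewrite wedge1E; last exact: alternating_wedge_pow2.
(* Only the first term survives, as theta kills the other vectors. *)
rewrite big_ord_recl big1 ?addr0 => [|i _]; last first.
  rewrite /form1 /v liftK theta_logvec // /A.
  by case: ifP => _; rewrite ?mZ ?dotv0r mulr0 mul0r.
rewrite /form1 {1}/v unlift_none theta_logvec // expr0 mul1r mulf_neq0 ?gt_eqF //.
apply: wedge_pow2_symplectic_gt0 => f.
have -> : (fun x => v (lift ord0 x)) \o f = fun i => logvec z (B (f i)) (A (f i)).
  by apply/funext => i /=; rewrite /v liftK.
rewrite (ext_d_theta finLP neLP (fun i => B (f i)) (fun i => A (f i)) tz) -/M !BM /A.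
have -> : (f ord0)./2 == (f ord_max)./2 = (half_ord (f ord0) == half_ord (f ord_max)) by [].
case: (odd (f ord0)); case: (odd (f ord_max));
  rewrite ?[dotv 0 _]dotvC ?dotv0r ?YZ ?subrr ?subr0 ?sub0r ?if_same //=.
- by rewrite eq_sym; case: eqP; rewrite ?oppr0.
- by case: eqP.
Qed.

End Contact.

(** * Slopes on full-dimensional cones and the final assembly *)

Section Slopes.
Context {R : realType} {n : nat}.
Variables (Sigma : set (set 'rV[R]_n)) (phi : 'rV[R]_n -> R).

Lemma slopeP sigma x : PL Sigma phi -> Sigma sigma -> sigma x ->
  phi x = dotv (slope phi sigma) x.
Proof.
move=> [_ plphi] Ss; have [m hm] := plphi _ Ss.
by have := @xgetI _ 0 [set m | forall x, sigma x -> phi x = dotv m x] m hm; apply.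
Qed.

Lemma full_cone_inj sigma (m m' : 'rV[R]_n) : cone_dim sigma n ->
  (forall x, sigma x -> dotv m x = dotv m' x) -> m = m'.
Proof.
move=> [A [freeA rowsA _]] mm'; apply/eqP; rewrite -subr_eq0 -trmx_eq0.
have uA : A \in unitmx by rewrite -row_free_unit.
rewrite -[_^T](mulKmx uA) (_ : A *m _ = 0) ?mulmx0 //.
apply/colP => i; rewrite !mxE.
transitivity (dotv (m - m') (row i A)).
  by apply: eq_bigr => k _; rewrite !mxE mulrC.
by rewrite dotvBl mm' ?subrr.
Qed.
End Slopes.

(** [slope] is a choice, so the two sides are compared through uniqueness on a cone containing a
    basis. *)
Lemma slope_scale (R : realType) n (Sigma : set (set 'rV[R]_n)) phi (c : R) sigma :
  PL Sigma phi -> PL Sigma (fun x => c * phi x) -> cones Sigma n sigma ->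
  slope (fun x => c * phi x) sigma = c *: slope phi sigma.
Proof.
move=> pl plc [Ss dims]; apply: (full_cone_inj dims) => x sx.
by rewrite -(slopeP plc Ss sx) dotvZl -(slopeP pl Ss sx).
Qed.

Theorem theorem1p3 (R : realType) (n : nat) (n_ge1 : (1 <= n)%N)
    (Sigma : set (set 'rV[R]_n)) (fanSigma : complete_fan Sigma)
    (phi : 'rV[R]_n -> R)
    (phi_rat : rational_PL Sigma phi) (phi_conc : strictly_concave Sigma phi)
    (r : nat) (r_gt0 : (0 < r)%N)
    (rphi_int : integral_PL Sigma (fun x => r%:R * phi x))
    (phi_neg : forall rho, cones Sigma 1 rho -> phi (prim_gen rho) < 0)
    (delta : R) (delta_gt0 : 0 < delta)
    (eps : set 'rV[R]_n -> R)
    (eps_gt0 : forall rho, cones Sigma 1 rho -> 0 < eps rho)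
    (eps_lt : forall rho, cones Sigma 1 rho ->
       eps rho < - (r%:R * phi (prim_gen rho))) :
  let rphi := fun x => r%:R * phi x in
  boundary_in torus (sublevel Sigma rphi eps delta)
    = level Sigma rphi eps delta /\
  restricts_to_contact_form n (level Sigma rphi eps delta) (theta Sigma rphi).
Proof.
move=> rphi; have [plphi _] := phi_rat; have [plr slopeZ] := rphi_int.
have [le_slope attained attainedP] := phi_conc.
have r0 : 0 < r%:R :> R by rewrite ltr0n.
have finLP := finite_lattice_points fanSigma plr.
have finS : finite_set Sigma by case: fanSigma.
have scSigma sigma : Sigma sigma -> strongly_convex sigma.
  by case: fanSigma => _ h _ _ _ /h [].
(* That phi lies below each of its slopes says exactly that r m_sigma satisfies the inequalities of
   the polytope. *)
have slopeLP sigma : cones Sigma n sigma ->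
    exists2 u, lattice_points Sigma rphi u & intv u = r%:R *: slope phi sigma.
  move=> Ss; have [u su] := slopeZ _ Ss; rewrite (slope_scale plphi plr Ss) in su.
  by exists u => // rho _; rewrite -su dotvZl ler_pM2l // le_slope.
have neLP : exists u, lattice_points Sigma rphi u.
  by have [sigma Ss _] := attained 0; have [u] := slopeLP _ Ss; exists u.
(* All slopes take the same value on b, so phi(b) and phi(-b) are both computed by m_sigma. By
   strict concavity b and -b lie in sigma, whence b = 0. *)
have spanLP b (c : R) : (forall u, lattice_points Sigma rphi u -> dotv (intv u) b = c) -> b = 0.
  move=> hb; have slb sigma : cones Sigma n sigma -> dotv (slope phi sigma) b = c / r%:R.
    move=> Ss; have [u /hb <- ->] := slopeLP _ Ss.
    by rewrite dotvZl mulrC mulKf // gt_eqF.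
  have [sigma Ss sb] := attained b; have [tau Ts tb] := attained (- b).
  apply: (scSigma sigma (proj1 Ss)); apply/(attainedP _ Ss); first exact: sb.
  by rewrite tb !dotvNr !slb.
have psi_neg rho : cones Sigma 1 rho -> rphi (prim_gen rho) < 0.
  by move=> /phi_neg h; rewrite /rphi pmulr_rlt0.
split; first exact: boundary_sublevel.
split.
- move=> z Sz; exists (fun w => hamiltonian Sigma rphi eps w - delta).
  exact: level_local_equation.
- exists torus; split; [exact: open_torus | by move=> z [] | exact: smooth_theta].
move=> z Sz; have [tz Hz] := Sz.
have Mu := moment_jacobian_unit finLP neLP tz spanLP.
have c0 : 0 < dotv (moment_map Sigma rphi z) (base_gradient Sigma rphi eps z).
  by apply: moment_gradient_gt0 => //; rewrite Hz.
have [v [tv wv]] := wedge_theta_neq0 n_ge1 finLP neLP tz Mu c0.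
exists v; split=> // i; have [b [a [-> h]]] := tv i.
exact: tangent_logvec.
Qed.
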